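(* Let $k \geq 1$ be an integer. There exist an integer $N_0(k)$ and a function $c_k:[0,\infty)\to[0,\infty)$ depending only on $k$ with $c_k(\varepsilon) \to 0$ as $\varepsilon \to 0$, such that for every integer $N \geq N_0(k)$ and every $f: [N] \to \mathbf{C}$ with $\|f\|_{L^\infty([N])} \leq 1$: (1) (Extremisers) $\|f\|_{U^k([N])} = 1$ if and only if $f = e(P)$ on $[N]$ for some polynomial $P: \mathbf{Z} \to \mathbf{R}/\mathbf{Z}$ of degree $\leq k-1$; (2) (Near-extremisers) for every $\varepsilon \geq 0$, if $\|f\|_{U^k([N])} \geq 1-\varepsilon$ then there exists a polynomial $P: \mathbf{Z} \to \mathbf{R}/\mathbf{Z}$ of degree $\leq k-1$ such that $\|f-e(P)\|_{L^1([N])} \leq c_k(\varepsilon)$.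
   Context: $[N] := \{1,\dots,N\}$, and $L^p([N])$ norms are taken with respect to normalised counting measure, e.g. $\|g\|_{L^1([N])} = \frac1N\sum_{n=1}^N |g(n)|$. For a finite abelian group $G$ with normalised counting measure, the Gowers norm is $\|f\|_{U^k(G)} := \left(\mathbb{E}_{x,h_1,\dots,h_k \in G} \prod_{\omega \in \{0,1\}^k} \mathcal{C}^{|\omega|} f(x+\omega_1h_1+\dots+\omega_kh_k)\right)^{1/2^k}$, with $\mathcal{C}$ complex conjugation and $|\omega|=\omega_1+\dots+\omega_k$. For $f:[N]\to\mathbf{C}$, $\|f\|_{U^k([N])} := \|\tilde f\|_{U^k(\mathbf{Z}/\tilde N\mathbf{Z})}/\|1_{[N]}\|_{U^k(\mathbf{Z}/\tilde N\mathbf{Z})}$, where $\tilde N > 2^k N$ is any integer (the value is independent of this choice), $[N]$ is embedded in $\mathbf{Z}/\tilde N\mathbf{Z}$ in the obvious way and $\tilde f$ is the extension of $f$ by zero. A map $P: \mathbf{Z} \to \mathbf{R}/\mathbf{Z}$ is a polynomial of degree $\leq d$ if $\Delta_{h_1}\cdots\Delta_{h_{d+1}}P \equiv 0$ for all $h_i \in \mathbf{Z}$, where $\Delta_h P(x) := P(x-h)-P(x)$; equivalently $P(n) = \sum_{i=0}^d c_i n^i \bmod 1$ with $c_i \in \mathbf{R}$. $e(x) := e^{2\pi i x}$. *)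

(* Defs.v *)
From HB Require Import structures.
From mathcomp Require Import all_boot all_order all_algebra.
From mathcomp Require Import all_classical all_reals all_analysis.
From mathcomp Require Import complex.
Set Implicit Arguments. Unset Strict Implicit. Unset Printing Implicit Defensive.
Import Order.TTheory GRing.Theory Num.Theory.
Local Open Scope ring_scope.

Section Gowers.
Variable R : realType.

Definition conjn (m : nat) (z : R[i]) : R[i] := if odd m then conjc z else z.

Definition gowers_avg (k M : nat) (g : nat -> R[i]) : R[i] :=
  ((M%:R ^- k.+1 : R)%:C)%C *
  \sum_(x < M) \sum_(h : {ffun 'I_k -> 'I_M})
     \prod_(w : {ffun 'I_k -> bool})
        conjn (\sum_(i < k) (w i : nat))%N
              (g ((x + \sum_(i < k) (w i : nat) * h i) %% M)%N).

(* ||g||_{U^k(Z/MZ)} = (average)^(1/2^k); the average is a non-negative real,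
   we take its real part. *)
Definition gowers_cyc (k M : nat) (g : nat -> R[i]) : R :=
  powR (complex.Re (gowers_avg k M g)) (2%:R ^- k).

Definition ext0 (N : nat) (f : nat -> R[i]) (x : nat) : R[i] :=
  if (1 <= x <= N)%N then f x else 0.

(* ||f||_{U^k([N])}, computed with Ntilde := 2^k N + 1 > 2^k N *)
Definition gowers_interval (k N : nat) (f : nat -> R[i]) : R :=
  gowers_cyc k (2 ^ k * N).+1 (ext0 N f) /
  gowers_cyc k (2 ^ k * N).+1 (ext0 N (fun _ => 1)).

Definition e (x : R) : R[i] := (cos (2 * pi * x) +i* sin (2 * pi * x))%C.

Definition L1 (N : nat) (g : nat -> R[i]) : R :=
  N%:R^-1 * \sum_(1 <= n < N.+1) ComplexField.Normc.normc (g n).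

(* a polynomial Z -> R/Z of degree <= d is n |-> sum c_i n^i mod 1;
   e(P(n)) is represented through a real polynomial p with size p <= d+1 *)
Definition ePoly (p : {poly R}) (n : nat) : R[i] := e p.[n%:R].

End Gowers.

(* Main.v *)
Require Import Defs.
From HB Require Import structures.
From mathcomp Require Import all_boot all_order all_algebra.
From mathcomp Require Import all_classical all_reals all_analysis.
From mathcomp Require Import complex.
From mathcomp Require Import zify ring lra.
Import Order.TTheory GRing.Theory Num.Theory.
Set Implicit Arguments.
Unset Strict Implicit.
Unset Printing Implicit Defensive.
Local Open Scope ring_scope.

(** Expanding the Gowers average over Z/MZ and discarding the cubes that wrap
    around, a norm at least 1 - eps bounds the sum of 1 - Re over all cubes of
    nonnegative directions in [N] by O(eps N^(k+1)), hence that of the defects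
    |1 - cube| by O(sqrt eps N^(k+1)).  On a short initial segment, replace
    f(x) by the average g(x), over cubes cornered at x, of the value which the
    other vertices predict at x.  Two predictions at x differ by the defect of
    a generic cube, so g is close to f on average; and an arbitrary cube of g
    is, up to predictions, a product of generic cubes of f, so every cube of g
    has defect O(sqrt eps).  A phase of g then lifts to a real function all of
    whose k-th differences are small, and Hyers-Ulam stability of polynomials
    gives p with g close to e(p).  Finally, for f e(-p), the cubes with top
    vertex x and the other vertices in the segment propagate closeness to 1 to a
    longer segment, and boundedly many such steps reach [N].  For eps = 0
    all cubes are exactly 1 and interpolation suffices. *)

(** * Complex norms, lists and cubes *)

(** The hypothesis controls only most cubes, whereas lifting to the reals and Hyers-Ulam need every
    cube of a segment. Predictions remove the exceptional cubes because, for one fixed corner [x],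
    the k directions and a shift of the base point are already k + 1 free parameters, as many as a
    whole family of cubes has. Predictions therefore agree on average at every single [x], not
    merely at most of them, and the cubes of g are all controlled although f is corrected only on
    average. Every segment has length at least a constant times N: an average over the cubes of a
    segment of length H inherits the bound for [N] at the price of (N/H)^(k+1), so all losses depend
    on k alone. The passage from 1 - Re to an absolute value is the only step that costs a square
    root; every later bound is linear in the average defect, hence the final rate is a multiple of
    sqrt eps. *)

Local Notation nc := ComplexField.Normc.normc.
Local Arguments conjc : simpl never.

Section ComplexNorm.
Variable R : realType.
Implicit Types (z w : R[i]) (r : R).

Lemma nc_ge0 z : 0 <= nc z.
Proof. by case: z => a b; rewrite sqrtr_ge0. Qed.

Lemma nc0 : nc (0 : R[i]) = 0.
Proof. exact: ComplexField.Normc.normc0. Qed.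

Lemma nc1 : nc (1 : R[i]) = 1.
Proof. exact: ComplexField.Normc.normc1. Qed.

Lemma ncM z w : nc (z * w) = nc z * nc w.
Proof. exact: ComplexField.Normc.normcM. Qed.

Lemma ncJ z : nc (conjc z) = nc z.
Proof. by case: z => a b /=; rewrite sqrrN. Qed.

Lemma ncN z : nc (- z) = nc z.
Proof. by case: z => a b /=; rewrite !sqrrN. Qed.

Lemma ncB z w : nc (z - w) = nc (w - z).
Proof. by rewrite -ncN opprB. Qed.

Lemma nc_real r : nc (r%:C)%C = `|r|.
Proof. by rewrite /= expr0n /= addr0 sqrtr_sqr. Qed.

Lemma ncE z : ((nc z)%:C)%C = `|z|.
Proof. by case: z. Qed.

Lemma nc_leD z w : nc (z + w) <= nc z + nc w.
Proof. by have := ler_normD z w; rewrite -!ncE -rmorphD/= lecR. Qed.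

Lemma nc_leB z w : nc (z - w) <= nc z + nc w.
Proof. by rewrite -(ncN w) nc_leD. Qed.

Lemma nc_triangle y z w : nc (z - w) <= nc (z - y) + nc (y - w).
Proof. by have := nc_leD (z - y) (y - w); rewrite addrA subrK. Qed.

Lemma nc_sum (I : Type) (s : seq I) (F : I -> R[i]) :
  nc (\sum_(i <- s) F i) <= \sum_(i <- s) nc (F i).
Proof.
elim: s => [|a s IH]; first by rewrite !big_nil nc0.
by rewrite !big_cons (le_trans (nc_leD _ _)) // lerD2l.
Qed.

Lemma mul_conjc z : z * conjc z = ((nc z ^+ 2)%:C)%C.
Proof. by rewrite -sqr_normc // -ncE rmorphXn. Qed.

Lemma nc_sqr z : nc z ^+ 2 = complex.Re z ^+ 2 + complex.Im z ^+ 2.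
Proof. by case: z => a b /=; rewrite sqr_sqrtr // addr_ge0 ?sqr_ge0. Qed.

Lemma Re_le_nc z : complex.Re z <= nc z.
Proof.
case: z => a b /=; rewrite (le_trans (ler_norm _)) // -sqrtr_sqr.
by rewrite ler_wsqrtr // lerDl sqr_ge0.
Qed.

(** Expand |1 - z|^2 = 1 - 2 Re z + |z|^2. This is where the square root is lost. *)
Lemma nc_1B_le z : nc z <= 1 -> nc (1 - z) ^+ 2 <= 2 * (1 - complex.Re z).
Proof.
move=> z1; have : nc z ^+ 2 <= 1 by rewrite expr_le1 ?nc_ge0.
rewrite !nc_sqr; case: z {z1} => a b /=; lra.
Qed.

Lemma Re_eq1 z : nc z <= 1 -> 1 <= complex.Re z -> z = 1.
Proof.
move=> z1 rz; have := nc_1B_le z1 => h.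
have /eqP : nc (1 - z) ^+ 2 = 0 by apply/eqP; rewrite eq_le sqr_ge0 andbT; lra.
rewrite sqrf_eq0 => /eqP /ComplexField.Normc.eq0_normc /eqP.
by rewrite subr_eq0 => /eqP.
Qed.

Lemma nc_mulB y z w : nc y <= 1 -> nc (y * z - y * w) <= nc (z - w).
Proof. by move=> y1; rewrite -mulrBr ncM ler_piMl ?nc_ge0. Qed.

Lemma nc_mul_le1 z w : nc z <= 1 -> nc w <= 1 -> nc (z * w) <= 1.
Proof. by move=> *; rewrite ncM mulr_ile1 ?nc_ge0. Qed.

Lemma nc_mulBmul y z u w : nc y <= 1 -> nc w <= 1 ->
  nc (y * z - u * w) <= nc (y - u) + nc (z - w).
Proof.
move=> y1 w1; have -> : y * z - u * w = y * (z - w) + (y - u) * w by ring.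
rewrite (le_trans (nc_leD _ _)) // !ncM addrC lerD //.
  by rewrite ler_piMr ?nc_ge0.
by rewrite ler_piMl ?nc_ge0.
Qed.

Lemma nc_1Bmul z w : nc z <= 1 ->
  nc (1 - z * w) <= nc (1 - z) + nc (1 - w).
Proof.
move=> z1; have -> : 1 - z * w = (1 - z) + z * (1 - w) by ring.
by rewrite (le_trans (nc_leD _ _)) // lerD2l ncM ler_piMl ?nc_ge0.
Qed.

Lemma conjc1B z : 1 - conjc z = conjc (1 - z).
Proof. by rewrite rmorphB rmorph1. Qed.

Lemma nc_1BJ z : nc (1 - conjc z) = nc (1 - z).
Proof. by rewrite conjc1B ncJ. Qed.

Lemma nc_JB z w : nc (conjc z - conjc w) = nc (z - w).
Proof. by rewrite -rmorphB ncJ. Qed.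

Lemma nc_1B_ge z : 1 - nc z <= nc (1 - z).
Proof. by rewrite lerBlDr; have := nc_leD (1 - z) z; rewrite subrK nc1. Qed.

(** On the unit circle this is an equality with constant 1. In the disc, [d] also bounds 1 - |w|,
    hence 1 - |w|^2 by [2 * d]; the identity z - w = z (1 - |w|^2) + w (z conj(w) - 1) then gives
    3. *)
Lemma nc_1BmulJ z w : nc z <= 1 -> nc w <= 1 ->
  nc (z - w) <= 3 * nc (1 - z * conjc w).
Proof.
move=> z1 w1; set d := nc (1 - _).
have dw : 1 - nc w <= d.
  have := nc_1B_ge (z * conjc w); rewrite -/d ncM ncJ.
  have : nc z * nc w <= nc w by rewrite ler_piMl ?nc_ge0.
  lra.
have -> : z - w = z * (1 - w * conjc w) + w * (z * conjc w - 1) by ring.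
rewrite (le_trans (nc_leD _ _)) // !ncM [X in _ + _ * X]ncB -/d.
have -> : nc (1 - w * conjc w) = 1 - nc w ^+ 2.
  rewrite mul_conjc -(rmorph1 (real_complex R)) -rmorphB nc_real ger0_norm //.
  by rewrite subr_ge0 expr_le1 ?nc_ge0.
have w0 := nc_ge0 w; have z0 := nc_ge0 z; have d0 : 0 <= d := nc_ge0 _.
have : nc w * d <= d by rewrite ler_piMl.
have : nc z * (1 - nc w ^+ 2) <= 1 - nc w ^+ 2.
  by rewrite ler_piMl // subr_ge0 expr_le1.
have : (1 - nc w) * (1 + nc w) <= 2 * d.
  by rewrite mulrC ler_pM //; lra.
lra.
Qed.

End ComplexNorm.

Local Arguments ComplexField.Normc.normc : simpl never.

Section Lists.
Variable T : Type.

Fixpoint lists (k : nat) (L : seq T) : seq (seq T) :=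
  if k is k'.+1 then [seq a :: s | a <- L, s <- lists k' L] else [:: [::]].

Lemma big_lists0 (V : nmodType) (L : seq T) (f : seq T -> V) :
  \sum_(s <- lists 0 L) f s = f [::].
Proof. by rewrite big_seq1. Qed.

Lemma big_listsS (V : nmodType) k (L : seq T) (f : seq T -> V) :
  \sum_(s <- lists k.+1 L) f s =
  \sum_(a <- L) \sum_(s <- lists k L) f (a :: s).
Proof. by rewrite /= big_allpairs_dep. Qed.

Lemma size_lists k (L : seq T) : size (lists k L) = (size L ^ k)%N.
Proof. by elim: k => //= k IH; rewrite size_allpairs IH expnS. Qed.

Lemma big_lists_cat (V : nmodType) j k (L : seq T) (f : seq T -> V) :
  \sum_(s <- lists (j + k) L) f s =
  \sum_(a <- lists j L) \sum_(b <- lists k L) f (a ++ b).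
Proof.
elim: j f => [|j IH] f; first by rewrite big_lists0.
rewrite addSn !big_listsS; apply: eq_bigr => a _.
by rewrite IH.
Qed.

End Lists.

Section Cubes.
Variable R : realType.
Variables (A : Type) (add : A -> A -> A).
Implicit Types (f : A -> R[i]) (x : A) (hs : seq A).

(** Iterated multiplicative derivative. [A] and [add] are left general because cubes are taken over
    naturals, integers, and lists that themselves encode cubes. *)
Fixpoint cube hs f x : R[i] :=
  if hs is h :: hs' then cube hs' f x * conjc (cube hs' f (add x h)) else f x.

(* The value at [x] predicted by the other vertices of the cube. *)
Fixpoint face hs f x : R[i] :=
  if hs is h :: hs' then face hs' f x * cube hs' f (add x h) else 1.

Lemma cubeE hs f x : cube hs f x = f x * conjc (face hs f x).
Proof.
elim: hs => [|h hs IH] /=; first by rewrite conjc1 mulr1.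
by rewrite IH rmorphM mulrA.
Qed.

Lemma nc_cube_le1 hs f x : (forall y, nc (f y) <= 1) -> nc (cube hs f x) <= 1.
Proof.
by move=> f1; elim: hs x => [|h hs IH] x //=; rewrite nc_mul_le1 ?ncJ.
Qed.

Lemma nc_face_le1 hs f x : (forall y, nc (f y) <= 1) -> nc (face hs f x) <= 1.
Proof.
move=> f1; elim: hs x => [|h hs IH] x /=; first by rewrite nc1.
by rewrite nc_mul_le1 // nc_cube_le1.
Qed.

Lemma eq_cube hs f g : f =1 g -> cube hs f =1 cube hs g.
Proof. by move=> fg; elim: hs => [|h hs IH] x //=; rewrite !IH. Qed.

Lemma cubeM hs f g x :
  cube hs (fun y => f y * g y) x = cube hs f x * cube hs g x.
Proof. by elim: hs x => [|h hs IH] x //=; rewrite !IH rmorphM; ring. Qed.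

Lemma cubeJ hs f x : cube hs (fun y => conjc (f y)) x = conjc (cube hs f x).
Proof. by elim: hs x => [|h hs IH] x //=; rewrite !IH rmorphM. Qed.

Lemma faceM hs f g x :
  face hs (fun y => f y * g y) x = face hs f x * face hs g x.
Proof.
elim: hs x => [|h hs IH] x /=; first by rewrite mulr1.
by rewrite IH cubeM; ring.
Qed.

Lemma faceJ hs f x : face hs (fun y => conjc (f y)) x = conjc (face hs f x).
Proof.
elim: hs x => [|h hs IH] x /=; first by rewrite conjc1.
by rewrite IH cubeJ rmorphM.
Qed.

Hypothesis addAC : forall x y z, add (add x y) z = add (add x z) y.

Lemma cube_insert a h b f x : cube (a ++ h :: b) f x =
  cube (a ++ b) f x * conjc (cube (a ++ b) f (add x h)).
Proof.
elim: a x => [|u a IH] x //=.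
by rewrite !IH addAC !rmorphM; ring.
Qed.

(** Only the second factor depends on [h]. Two predictions that differ in one direction, [h] against
    [h + u], are therefore compared by one cube with base [x + h] and [u] inserted. *)
Lemma face_insert a h b f x :
  face (a ++ h :: b) f x = face (a ++ b) f x * cube (a ++ b) f (add x h).
Proof.
by elim: a x => [|u a IH] x //=; rewrite IH cube_insert addAC; ring.
Qed.

End Cubes.

Section CubeMorphism.
Variable R : realType.
Variables (A B : Type) (add : A -> A -> A) (add' : B -> B -> B).
Variables (p q : A -> B).
Hypothesis pq : forall x h, p (add x h) = add' (p x) (q h).

Lemma cube_comp hs (f : B -> R[i]) x :
  cube add hs (fun y => f (p y)) x = cube add' (map q hs) f (p x).
Proof. by elim: hs x => [|h hs IH] x //=; rewrite !IH pq. Qed.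

Lemma face_comp hs (f : B -> R[i]) x :
  face add hs (fun y => f (p y)) x = face add' (map q hs) f (p x).
Proof. by elim: hs x => [|h hs IH] x //=; rewrite IH cube_comp pq. Qed.

End CubeMorphism.

(** * Sums over boxes of directions *)

Section Sums.
Variable R : realType.

Lemma ler_sum_subset (J : eqType) (s t : seq J) (g : J -> R) :
  uniq s -> {subset s <= t} -> (forall j, 0 <= g j) ->
  \sum_(j <- s) g j <= \sum_(j <- t) g j.
Proof.
move=> us st g0; elim: s us t st => [|a s IH] /= us t st.
  by rewrite big_nil sumr_ge0.
case/andP: us => as' us.
have at' : a \in t by apply: st; rewrite mem_head.
rewrite big_cons (perm_big _ (perm_to_rem at')) big_cons lerD2l.
apply: IH => // j js; have jt : j \in t by apply: st; rewrite inE js orbT.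
move: jt; rewrite (perm_mem (perm_to_rem at')) inE; case/predU1P => // ja.
by move: as'; rewrite -ja js.
Qed.

Lemma ler_sum_inj (I J : eqType) (s : seq I) (t : seq J) (p : I -> J)
    (g : J -> R) :
  uniq s -> {in s &, injective p} -> (forall i, i \in s -> p i \in t) ->
  (forall j, 0 <= g j) ->
  \sum_(i <- s) g (p i) <= \sum_(j <- t) g j.
Proof.
move=> us pi pt g0; rewrite -(big_map p xpredT g); apply: ler_sum_subset => //.
  by rewrite map_inj_in_uniq.
by move=> j /mapP[i /pt it ->].
Qed.

Lemma uniq_lists (T : eqType) k (L : seq T) : uniq L -> uniq (lists k L).
Proof.
move=> uL; elim: k => //= k IH; apply: allpairs_uniq => //.
by move=> [a s] [b t] _ _ /= [-> ->].
Qed.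

Lemma mem_lists (T : eqType) k (L : seq T) s :
  (s \in lists k L) = (size s == k) && all (mem L) s.
Proof.
elim: k s => [|k IH] [|a s] //=.
  by apply/negP => /allpairsP[p [_ _]].
rewrite eqSS; apply/allpairsP/idP => [[[b t] /= [bL + [-> ->]]]|].
  by rewrite IH bL => /andP[-> ->].
by case/and3P=> sk aL sL; exists (a, s); rewrite /= IH sk.
Qed.

Definition box k H : seq (seq nat) := lists k (iota 0 H).

Lemma mem_box k H s :
  (s \in box k H) = (size s == k) && all (fun i => i < H)%N s.
Proof.
rewrite mem_lists; congr andb; apply: eq_all => i /=.
by rewrite mem_iota.
Qed.

Lemma uniq_box k H : uniq (box k H).
Proof. by rewrite uniq_lists ?iota_uniq. Qed.

Lemma size_box k H : size (box k H) = (H ^ k)%N.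
Proof. by rewrite size_lists size_iota. Qed.

Lemma sumn_box k H s : (s \in box k H) -> (sumn s <= k * H)%N.
Proof.
rewrite mem_box => /andP[/eqP <-].
elim: s => //= a s IH /andP[aH /IH]; lia.
Qed.

Lemma sumn_box_lt k H s : (0 < H)%N -> (s \in box k.+1 H) -> (sumn s < k.+1 * H)%N.
Proof.
move=> H0; rewrite mem_box; case: s => // a s /= /andP[sk /andP[aH sH]].
have : s \in box k H by rewrite mem_box sH -eqSS sk.
move/sumn_box; nia.
Qed.

(** The hypothesis is a weighted way of saying that [c] maps [L] to [L'] with fibres of at most [C]
    elements; fibre sizes multiply over the k entries. *)
Lemma ler_sum_map_lists (A B : eqType) (c : A -> B) (L : seq A) (L' : seq B)
    (C : R) k :
  0 <= C ->
  (forall g : B -> R, (forall b, 0 <= g b) ->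
     \sum_(a <- L) g (c a) <= C * \sum_(b <- L') g b) ->
  forall g : seq B -> R, (forall b, 0 <= g b) ->
    \sum_(r <- lists k L) g (map c r) <= C ^+ k * \sum_(r <- lists k L') g r.
Proof.
move=> C0 H1; elim: k => [|k IH] g g0; first by rewrite !big_lists0 mul1r.
rewrite !big_listsS exprSr -mulrA /=.
apply: (@le_trans _ _ (\sum_(a <- L) C ^+ k * \sum_(r <- lists k L') g (c a :: r))).
  by apply: ler_sum => a _; apply: (IH (fun r => g (c a :: r))).
rewrite -mulr_sumr ler_wpM2l ?exprn_ge0 //.
apply: (H1 (fun b => \sum_(r <- lists k L') g (b :: r))) => b.
by apply: sumr_ge0.
Qed.

Lemma sum_const_seq (I : Type) (s : seq I) (a : R) :
  \sum_(i <- s) a = (size s)%:R * a.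
Proof. by rewrite big_const_seq count_predT iter_addr_0 mulr_natl. Qed.

Lemma ler_sum_in (I : eqType) (s : seq I) (F G : I -> R) :
  (forall i, i \in s -> F i <= G i) -> \sum_(i <- s) F i <= \sum_(i <- s) G i.
Proof. by move=> FG; rewrite big_seq [X in _ <= X]big_seq ler_sum. Qed.

(* Passing from [t] to [u] by replacing one entry at a time. *)
Lemma sum_resample (L : seq nat) (k : nat) (F : seq nat -> R[i]) (r : R) :
  (forall i j, (i + j).+1 = k ->
    \sum_(a <- lists i L) \sum_(b <- lists j L) \sum_(h <- L) \sum_(h' <- L)
       nc (F (a ++ h :: b) - F (a ++ h' :: b)) <= r) ->
  (size L)%:R * \sum_(t <- lists k L) \sum_(u <- lists k L) nc (F t - F u)
    <= k%:R * (size L)%:R ^+ k * r.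
Proof.
move=> hr; set T := (size L)%:R; have T0 : 0 <= T by rewrite ler0n.
(* The [i] leading entries are common to both lists and are averaged over; induction is on the
   number [j] of entries that may still differ. *)
suff P i j : (i + j)%N = k -> T * \sum_(a <- lists i L)
    \sum_(t <- lists j L) \sum_(u <- lists j L) nc (F (a ++ t) - F (a ++ u))
    <= j%:R * T ^+ j * r.
  by have := P 0%N k; rewrite big_lists0; apply.
elim: j i => [|j IH] i ijk.
  rewrite mul0r mul0r big1 ?mulr0 // => a _.
  by rewrite !big_lists0 subrr nc0.
have H1 : \sum_(a <- lists i L)
    \sum_(t <- lists j.+1 L) \sum_(u <- lists j.+1 L) nc (F (a ++ t) - F (a ++ u))
  <= T * (\sum_(a <- lists i.+1 L)
    \sum_(t <- lists j L) \sum_(u <- lists j L) nc (F (a ++ t) - F (a ++ u)))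
   + T ^+ j * r.
  have -> : \sum_(a <- lists i.+1 L) \sum_(t <- lists j L) \sum_(u <- lists j L)
       nc (F (a ++ t) - F (a ++ u)) =
     \sum_(a <- lists i L) \sum_(h <- L) \sum_(t <- lists j L)
       \sum_(u <- lists j L) nc (F (a ++ h :: t) - F (a ++ h :: u)).
    rewrite -addn1 big_lists_cat; apply: eq_bigr => a _.
    rewrite big_listsS; apply: eq_bigr => h _; rewrite big_lists0.
    by apply: eq_bigr => t _; apply: eq_bigr => u _; rewrite -!catA.
  apply: (@le_trans _ _ (T * (\sum_(a <- lists i L) \sum_(h <- L)
      \sum_(t <- lists j L) \sum_(u <- lists j L)
        nc (F (a ++ h :: t) - F (a ++ h :: u))) +
     T ^+ j * \sum_(a <- lists i L) \sum_(b <- lists j L) \sum_(h <- L)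
       \sum_(h' <- L) nc (F (a ++ h :: b) - F (a ++ h' :: b)))); last first.
    by rewrite lerD2l ler_wpM2l ?exprn_ge0 // hr // -ijk addnS.
  rewrite !mulr_sumr -big_split /=; apply: ler_sum => a _.
  rewrite big_listsS.
  rewrite (eq_bigr _ (fun h _ => eq_bigr _ (fun t _ => big_listsS _ _ _))).
  (* The intermediate list is [a ++ h :: u]: the tail is changed first, by induction, and the entry
     [h] afterwards. *)
  apply: (@le_trans _ _ (\sum_(h <- L) \sum_(t <- lists j L) \sum_(h' <- L)
     \sum_(u <- lists j L) (nc (F (a ++ h :: t) - F (a ++ h :: u)) +
        nc (F (a ++ h :: u) - F (a ++ h' :: u))))).
    do 4![apply: ler_sum => ? _]; exact: nc_triangle.
  have -> : \sum_(h <- L) \sum_(t <- lists j L) \sum_(h' <- L)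
     \sum_(u <- lists j L) (nc (F (a ++ h :: t) - F (a ++ h :: u)) +
        nc (F (a ++ h :: u) - F (a ++ h' :: u))) =
    \sum_(h <- L) \sum_(t <- lists j L) \sum_(h' <- L)
     \sum_(u <- lists j L) nc (F (a ++ h :: t) - F (a ++ h :: u)) +
    \sum_(h <- L) \sum_(t <- lists j L) \sum_(h' <- L)
     \sum_(u <- lists j L) nc (F (a ++ h :: u) - F (a ++ h' :: u)).
    by do 3![rewrite -big_split; apply: eq_bigr => ? _]; rewrite -big_split.
  apply: lerD.
    rewrite mulr_sumr; apply: ler_sum => h _.
    rewrite mulr_sumr; apply: ler_sum => t _.
    by rewrite sum_const_seq.
  apply: (@le_trans _ _ (\sum_(h <- L) T ^+ j * \sum_(h' <- L)
     \sum_(u <- lists j L) nc (F (a ++ h :: u) - F (a ++ h' :: u)))).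
    by apply: ler_sum => h _; rewrite sum_const_seq size_lists natrX.
  rewrite -mulr_sumr ler_wpM2l ?exprn_ge0 // [X in _ <= X]exchange_big /=.
  by apply: ler_sum => h _; rewrite exchange_big.
have H2 := IH i.+1 _; rewrite addSnnS in H2.
have := ler_wpM2l T0 H1; rewrite mulrDr => /le_trans; apply.
have -> : j.+1%:R * T ^+ j.+1 * r = T * (j%:R * T ^+ j * r) + T * (T ^+ j * r).
  by rewrite exprS -natr1; ring.
by rewrite lerD2r ler_wpM2l // H2.
Qed.

(** Directions are natural numbers, so a pair is first ordered and then written as [a], [a + u],
    where [u] can serve as a direction. *)
Lemma sum_symm_le (T : nat) (G : nat -> nat -> R) :
  (forall a b, 0 <= G a b) -> (forall a b, G a b = G b a) ->
  \sum_(a <- iota 0 T) \sum_(b <- iota 0 T) G a b <=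
  2 * \sum_(a <- iota 0 T) \sum_(u <- iota 0 T) G a (a + u)%N.
Proof.
move=> G0 GC.
have H : \sum_(a <- iota 0 T) \sum_(b <- iota 0 T | (a <= b)%N) G a b <=
   \sum_(a <- iota 0 T) \sum_(u <- iota 0 T) G a (a + u)%N.
  apply: ler_sum => a _; rewrite -big_filter.
  apply: (@le_trans _ _ (\sum_(b <- [seq b <- iota 0 T | (a <= b)%N]) G a (a + (b - a)%N)%N)).
    by apply: ler_sum_in => b; rewrite mem_filter => /andP[ab _]; rewrite subnKC.
  apply: (ler_sum_inj (p := fun b => (b - a)%N) (g := fun u => G a (a + u)%N)) => //.
  - by rewrite filter_uniq ?iota_uniq.
  - by move=> b c; rewrite !mem_filter => /andP[ab _] /andP[ac _] /=; lia.
  - by move=> b; rewrite mem_filter !mem_iota; lia.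
rewrite mulr_natl mulr2n.
apply: (@le_trans _ _ (\sum_(a <- iota 0 T) \sum_(b <- iota 0 T | (a <= b)%N) G a b +
  \sum_(a <- iota 0 T) \sum_(b <- iota 0 T | (b <= a)%N) G a b)); last first.
  apply: lerD => //.
  suff -> : \sum_(a <- iota 0 T) \sum_(b <- iota 0 T | (b <= a)%N) G a b =
    \sum_(a <- iota 0 T) \sum_(b <- iota 0 T | (a <= b)%N) G a b by [].
  rewrite [LHS](exchange_big_dep xpredT) //=; apply: eq_bigr => a _.
  by apply: eq_bigr => b _.
rewrite -big_split /=; apply: ler_sum => a _.
rewrite (bigID (fun b => (a <= b)%N)) /= lerD2l.
rewrite [X in _ <= X](bigID (fun b => (b < a)%N)) /=.
rewrite (eq_bigl (fun b => (b <= a) && (b < a))%N); last by move=> b /=; lia.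
by rewrite lerDl sumr_ge0.
Qed.

End Sums.

(** * Self-correction *)

Section SelfCorrection.
Variable R : realType.
Local Notation cubeN := (cube addn).
Local Notation faceN := (face addn).

Definition defect (f : nat -> R[i]) (u : seq nat) : R :=
  nc (1 - cubeN (behead u) f (head 0%N u)).

Lemma defect_ge0 f u : 0 <= defect f u.
Proof. exact: nc_ge0. Qed.

(* A cube is encoded by the list [x :: hs] of its base point and its
   directions; it lies in [0, N) iff [x + sum hs < N]. *)
Definition cubes k N : seq (seq nat) := [seq u <- box k.+1 N | (sumn u < N)%N].

Lemma mem_cubes k N u : (u \in cubes k N) = (size u == k.+1) && (sumn u < N)%N.
Proof.
rewrite mem_filter mem_box andbC -andbA; congr andb; apply/andP/idP => [[]//|uN].
split=> //; apply/allP => i iu; apply: leq_ltn_trans uN.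
by rewrite (perm_sumn (perm_to_rem iu)) /= leq_addr.
Qed.

Lemma uniq_cubes k N : uniq (cubes k N).
Proof. by rewrite filter_uniq ?uniq_box. Qed.

(* Padded pointwise addition makes [head], [behead] and the two contractions
   below additive without any assumption on lengths. *)
Fixpoint ladd (a b : seq nat) : seq nat :=
  match a, b with
  | [::], _ => b
  | _, [::] => a
  | x :: a', y :: b' => (x + y)%N :: ladd a' b'
  end.

Lemma ladd0 a : ladd a [::] = a. Proof. by case: a. Qed.

Lemma laddC : commutative ladd.
Proof. by elim=> [|x a IH] [|y b] //=; rewrite IH addnC. Qed.

Lemma laddA : associative ladd.
Proof. by elim=> [|x a IH] [|y b] [|z c] //=; rewrite IH addnA. Qed.

Lemma laddAC : right_commutative ladd.
Proof. by move=> a b c; rewrite -!laddA (laddC b). Qed.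

Lemma head_ladd a b : head 0%N (ladd a b) = (head 0 a + head 0 b)%N.
Proof. by case: a b => [|x a] [|y b] //=; rewrite addn0. Qed.

Lemma behead_ladd a b : behead (ladd a b) = ladd (behead a) (behead b).
Proof. by case: a b => [|x a] [|y b] //=; rewrite ladd0. Qed.

Lemma size_ladd a b : size a = size b -> size (ladd a b) = size b.
Proof. by elim: a b => [|x a IH] [|y b] //= [] /IH ->. Qed.

Lemma sumn_ladd a b : sumn (ladd a b) = (sumn a + sumn b)%N.
Proof. by elim: a b => [|x a IH] [|y b] //=; rewrite ?IH; lia. Qed.

Lemma ladd_inj a b c : size b = size a -> size c = size a ->
  ladd a b = ladd a c -> b = c.
Proof.
elim: a b c => [|x a IH] [|y b] [|z c] //= [sb] [sc] [xyz abc].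
by rewrite (IH b c) //; congr cons; lia.
Qed.

(** The two contractions send an encoded cube to its two facets across the first direction, based at
    x and at x + h. *)
Definition contract0 (u : seq nat) := head 0%N u :: behead (behead u).
Definition contract1 (u : seq nat) :=
  (head 0 u + head 0 (behead u))%N :: behead (behead u).

Lemma contract0_ladd a b : contract0 (ladd a b) = ladd (contract0 a) (contract0 b).
Proof. by rewrite /contract0 !behead_ladd head_ladd. Qed.

Lemma contract1_ladd a b : contract1 (ladd a b) = ladd (contract1 a) (contract1 b).
Proof. by rewrite /contract1 !behead_ladd !head_ladd /= addnACA. Qed.

(** Seeing the value of a cube as a function of its whole code allows cubes and faces of that
    function under [ladd], in which base point and directions move together. *)
Fixpoint lcube n (f : nat -> R[i]) (u : seq nat) : R[i] :=
  if n is n'.+1 then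
    lcube n' f (contract0 u) * conjc (lcube n' f (contract1 u))
  else f (head 0%N u).

Lemma lcubeE hs f x : lcube (size hs) f (x :: hs) = cubeN hs f x.
Proof. by elim: hs x => [|h hs IH] x //=; rewrite -!IH. Qed.

Lemma nc_lcube_le1 n f u : (forall y, nc (f y) <= 1) -> nc (lcube n f u) <= 1.
Proof.
by move=> f1; elim: n u => [|n IH] u //=; rewrite nc_mul_le1 ?ncJ.
Qed.

Lemma sum_cubes_translate k N L (g : seq nat -> R) (z : seq nat) :
  (forall u, 0 <= g u) -> size z = k.+1 -> uniq L ->
  (forall d, d \in L -> size d = k.+1 /\ (sumn z + sumn d < N)%N) ->
  \sum_(d <- L) g (ladd z d) <= \sum_(u <- cubes k N) g u.
Proof.
move=> g0 sz uL hL; apply: ler_sum_inj => //.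
- by move=> b c /hL[sb _] /hL[sc _]; apply: ladd_inj; rewrite sz.
- move=> d /hL[sd dN]; rewrite mem_cubes sumn_ladd dN andbT.
  by rewrite size_ladd ?sz ?sd.
Qed.

(** * Cubes and faces of a function that is close to 1 on average *)

Section Averaging.
Variables (A : eqType) (add : A -> A -> A) (phi : A -> R[i]).
Variables (L : seq A) (W : R) (P : nat -> A -> Prop).
Hypothesis addAC : forall x y z, add (add x y) z = add (add x z) y.
Hypothesis phi1 : forall y, nc (phi y) <= 1.
Hypothesis PS : forall m z, P m.+1 z -> P m z.
Hypothesis Padd : forall m z d, P m.+1 z -> d \in L -> P m (add z d).
Hypothesis PW : forall z, P 0 z -> \sum_(d <- L) nc (1 - phi (add z d)) <= W.

(** [P m z] means that [z] leaves room for [m] further shifts by entries of [L]. The cube has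
    [2 ^ size ds] vertices; at each of them the average over [d] costs [W]. *)
Lemma sum_1Bcube ds z : {subset ds <= L} -> P (size ds) z ->
  \sum_(d <- L) nc (1 - cube add ds phi (add z d)) <= 2 ^+ size ds * W.
Proof.
elim: ds z => [|d1 ds IH] z dsL Pz; first by rewrite mul1r PW.
have dsL' : {subset ds <= L} by move=> d dd; apply: dsL; rewrite inE dd orbT.
have d1L : d1 \in L by apply: dsL; rewrite mem_head.
apply: (@le_trans _ _ (\sum_(d <- L) (nc (1 - cube add ds phi (add z d)) +
   nc (1 - cube add ds phi (add (add z d1) d))))).
  apply: ler_sum => d _ /=; rewrite addAC -[X in _ <= _ + X]nc_1BJ.
  by rewrite nc_1Bmul // nc_cube_le1.
rewrite big_split /= exprS -mulrA mulr_natl mulr2n lerD ?IH //.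
  exact: PS.
exact: Padd.
Qed.

(** A face omits the vertex [y] itself, so each of its vertices is moved by at least one entry of
    [r]. Averaging over [r] thus gives a bound at every [y], even where [phi y] is not near 1. *)
Lemma sum_1Bface k y : P k y ->
  (size L)%:R * \sum_(r <- lists k L) nc (1 - face add r phi y)
    <= k%:R * 2 ^+ k * (size L)%:R ^+ k * W.
Proof.
set T := (size L)%:R; have T0 : 0 <= T by rewrite ler0n.
elim: k => [|k IH] Pk.
  by rewrite big_lists0 /= subrr nc0 mulr0 !mul0r.
have W0 : 0 <= W.
  suff P0 : P 0 y by apply: le_trans (PW P0); apply: sumr_ge0 => *; apply: nc_ge0.
  by elim: k Pk {IH} => [|k IH] /PS.
have H1 : \sum_(r <- lists k.+1 L) nc (1 - face add r phi y) <=
   T * \sum_(r <- lists k L) nc (1 - face add r phi y) + T ^+ k * (2 ^+ k * W).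
  rewrite big_listsS.
  apply: (@le_trans _ _ (\sum_(d <- L) \sum_(r <- lists k L)
    (nc (1 - face add r phi y) + nc (1 - cube add r phi (add y d))))).
    apply: ler_sum => d _; apply: ler_sum => r _ /=.
    by rewrite nc_1Bmul // nc_face_le1.
  under eq_bigr do rewrite big_split /=.
  rewrite big_split /= sum_const_seq lerD2l exchange_big /=.
  apply: (@le_trans _ _ (\sum_(r <- lists k L) 2 ^+ k * W)).
    apply: ler_sum_in => r; rewrite mem_lists => /andP[/eqP sr /allP rL].
    by rewrite -sr; apply: sum_1Bcube => //; rewrite sr; apply: PS.
  by rewrite sum_const_seq size_lists natrX.
apply: le_trans (ler_wpM2l T0 H1) _.
have {}IH := IH (PS Pk); rewrite mulrDr.
have h2 := ler_wpM2l T0 IH.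
have -> : k.+1%:R * 2 ^+ k.+1 * T ^+ k.+1 * W =
   T * (k%:R * 2 ^+ k * T ^+ k * W) + T * (T ^+ k * (2 ^+ k * W)) +
   (k.+1%:R * 2 ^+ k * T ^+ k.+1 * W) by rewrite !exprS -natr1; ring.
rewrite -addrA lerD // lerDl.
by rewrite !mulr_ge0 ?exprn_ge0.
Qed.

End Averaging.
Variables (k N H : nat) (f : nat -> R[i]) (S : R).
Hypothesis H0 : (0 < H)%N.
Hypothesis HN : (k.+2 ^ 2 * H <= N)%N.
Hypothesis f1 : forall y, nc (f y) <= 1.
Hypothesis sumS : \sum_(u <- cubes k N) defect f u <= S.

(** A contraction may add a direction below [H] to a base shift; after k of them a shift below [H]
    is below [(k + 1) * H], and predictions must use at least that range. A base point below [H]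
    moved by k + 1 steps below [T] stays in [0, N) since H + (k+1)^2 H <= (k+2)^2 H. *)
Let T := (k.+1 * H)%N.

Let S0 : 0 <= S.
Proof. by apply: le_trans sumS; apply: sumr_ge0 => *; apply: defect_ge0. Qed.

Let T0 : (0 : R) < T%:R.
Proof. by rewrite ltr0n muln_gt0 H0. Qed.

Definition corrected x : R[i] :=
  ((((T ^ k)%:R)^-1 : R)%:C)%C * \sum_(t <- box k T) faceN t f x.

(** Here [x] is fixed: the shift [h] and the k directions run through distinct cubes of [0, N), so
    their defects sum to at most the total [S]. *)
Lemma sum_corner_defect i j x : (i + j).+1 = k -> (x < H)%N ->
  \sum_(a <- box i T) \sum_(b <- box j T) \sum_(h <- iota 0 T)
    \sum_(u <- iota 0 T) defect f ((x + h)%N :: a ++ u :: b) <= S.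
Proof.
move=> ijk xH; apply: le_trans sumS.
have -> : \sum_(a <- box i T) \sum_(b <- box j T) \sum_(h <- iota 0 T)
    \sum_(u <- iota 0 T) defect f ((x + h)%N :: a ++ u :: b) =
  \sum_(d <- box k.+1 T) defect f ((x + head 0%N d)%N :: behead d).
  rewrite /box big_listsS -ijk -addnS.
  under [RHS]eq_bigr do rewrite big_lists_cat.
  rewrite [RHS]exchange_big; apply: eq_bigr => a _.
  rewrite exchange_big; apply: eq_bigr => h _.
  rewrite exchange_big [RHS]big_listsS; apply: eq_bigr => u _.
  by apply: eq_bigr.
apply: (ler_sum_inj (p := fun d => (x + head 0 d)%N :: behead d)) => //.
- exact: uniq_box.
- move=> [|b bs] [|c cs]; rewrite !mem_box //= => _ _ [xbc ->].
  by congr cons; lia.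
- move=> [|d ds] dT; move: (dT); rewrite mem_box //= => /andP[sd _].
  rewrite mem_cubes /= sd /=; have := sumn_box dT => /=.
  by move: HN; rewrite /T; nia.
- by move=> ?; apply: defect_ge0.
Qed.

Lemma sum_face_resample x : (x < H)%N ->
  T%:R * \sum_(t <- box k T) \sum_(u <- box k T) nc (faceN t f x - faceN u f x)
   <= k%:R * T%:R ^+ k * (6 * S).
Proof.
move=> xH; rewrite -{1 4}(size_iota 0 T); apply: sum_resample => i j ijk.
(* The factor 2 comes from ordering the two directions, the factor 3 from [nc_1BmulJ]. *)
rewrite -[6]/(2 * 3)%:R natrM -mulrA.
apply: (@le_trans _ _ (2 * (3 * \sum_(a <- box i T) \sum_(b <- box j T)
  \sum_(h <- iota 0 T) \sum_(u <- iota 0 T) defect f ((x + h)%N :: a ++ u :: b)))); last first.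
  by rewrite !ler_pM2l ?ltr0n //; apply: sum_corner_defect.
rewrite !mulr_sumr; apply: ler_sum => a _.
rewrite !mulr_sumr; apply: ler_sum => b _.
apply: le_trans (sum_symm_le _ _ _) _.
- by move=> *; apply: nc_ge0.
- by move=> *; rewrite ncB.
rewrite ler_pM2l ?ltr0n // mulr_sumr; apply: ler_sum => h _.
rewrite mulr_sumr; apply: ler_sum => u _.
rewrite !(face_insert addnAC); apply: le_trans (nc_mulB _ _ _) _.
  exact: nc_face_le1.
apply: le_trans (nc_1BmulJ _ _) _; rewrite ?nc_cube_le1 //.
by rewrite /defect /= (cube_insert addnAC) addnA.
Qed.

(** The difference from a mean is the mean of the differences, so pairwise agreement of predictions
    passes to [corrected] without further loss. *)
Lemma sum_face_corrected x : (x < H)%N ->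
  T%:R * \sum_(t <- box k T) nc (corrected x - faceN t f x) <= k%:R * (6 * S).
Proof.
move=> xH; have := sum_face_resample xH; set X := \sum_(t <- _) _ => hX.
have Tk : (0 : R) < T%:R ^+ k by rewrite exprn_gt0.
rewrite -(ler_pM2l Tk) [X in _ <= X]mulrCA mulrA; apply: le_trans hX.
rewrite mulrCA ler_pM2l // mulr_sumr /X exchange_big; apply: ler_sum => u _.
have -> : T%:R ^+ k * nc (corrected x - faceN u f x) =
   nc (\sum_(t <- box k T) (faceN t f x - faceN u f x)).
  rewrite -{1}[T%:R ^+ k]ger0_norm ?exprn_ge0 ?ler0n // -nc_real -ncM; congr nc.
  rewrite sumrB mulrBr /corrected mulrA; congr (_ - _).
    rewrite -rmorphM natrX mulfV ?rmorph1 ?mul1r //.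
    by rewrite gt_eqF.
  rewrite big_const_seq count_predT size_box iter_addr_0 -[RHS]mulr_natl.
  by rewrite -natrX rmorph_nat.
exact: nc_sum.
Qed.

Lemma nc_corrected_le1 x : nc (corrected x) <= 1.
Proof.
rewrite /corrected ncM nc_real ger0_norm ?invr_ge0 ?ler0n //.
have Tk : (0 : R) < (T ^ k)%:R by rewrite natrX exprn_gt0.
rewrite -(ler_pM2l Tk) mulrA mulfV ?gt_eqF // mul1r mulr1.
apply: le_trans (nc_sum _ _) _.
apply: (@le_trans _ _ (\sum_(t <- box k T) 1)).
  by apply: ler_sum => t _; apply: nc_face_le1.
by rewrite sum_const_seq size_box mulr1.
Qed.

(** Shifts of an encoded cube. The range [K] of the base point is kept apart from [H] because it
    grows by [H] at each contraction. *)
Definition shifts n K : seq (seq nat) := [seq x :: s | x <- iota 0 K, s <- box n H].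

Lemma big_shifts n K (g : seq nat -> R) : \sum_(d <- shifts n K) g d =
  \sum_(x <- iota 0 K) \sum_(s <- box n H) g (x :: s).
Proof. by rewrite /shifts big_allpairs_dep. Qed.

Lemma sum_contract0 n K (g : seq nat -> R) : (forall b, 0 <= g b) ->
  \sum_(a <- shifts n.+1 K) g (contract0 a) <=
  H%:R * \sum_(b <- shifts n (K + H)) g b.
Proof.
move=> g0; rewrite !big_shifts mulr_sumr iotaD big_cat /=.
rewrite -[X in X <= _]addr0 lerD //; last first.
  by apply: sumr_ge0 => *; rewrite mulr_ge0 ?ler0n //; apply: sumr_ge0.
apply: ler_sum => x _; rewrite /box big_listsS /contract0 /=.
by rewrite sum_const_seq size_iota.
Qed.

(** For each fixed direction [h], adding [h] is injective from [0, K) to [0, K + H), so a fibre has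
    at most [H] elements. *)
Lemma sum_contract1 n K (g : seq nat -> R) : (forall b, 0 <= g b) ->
  \sum_(a <- shifts n.+1 K) g (contract1 a) <=
  H%:R * \sum_(b <- shifts n (K + H)) g b.
Proof.
move=> g0; rewrite !big_shifts /contract1.
under eq_bigr do rewrite /box big_listsS /=.
rewrite exchange_big /=.
apply: (@le_trans _ _ (\sum_(h <- iota 0 H) \sum_(x <- iota 0 (K + H))
  \sum_(s <- box n H) g (x :: s))); last by rewrite sum_const_seq size_iota.
apply: ler_sum_in => h; rewrite mem_iota add0n => hH.
apply: (ler_sum_inj (p := fun x => (x + h)%N)
  (g := fun x => \sum_(s <- box n H) g (x :: s))) => //.
- exact: iota_uniq.
- by move=> a b _ _ /=; lia.
- by move=> x; rewrite !mem_iota; lia.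
- by move=> x; apply: sumr_ge0.
Qed.

(** Both terms factor over the two facets of [y]: contractions are additive and faces
    multiplicative. At a single vertex this is [sum_face_corrected]. Each step has two facets, and
    fibres of at most [H] for each of the k entries of [r], hence [2 * H ^ k]. *)
Lemma sum_lcube_corrected n K y : size y = n.+1 -> (sumn y < H)%N ->
  (K + n * H <= T)%N ->
  T%:R * \sum_(r <- lists k (shifts n K))
    nc (lcube n corrected y - face ladd r (lcube n f) y)
  <= (2 * H%:R ^+ k) ^+ n * (k%:R * (6 * S)).
Proof.
elim: n K y => [|n IH] K y sy yH KT.
  have xH : (head 0%N y < H)%N by case: y sy yH => //= x s _; lia.
  rewrite mul1r; apply: le_trans (sum_face_corrected xH).
  rewrite ler_pM2l //= -[X in _ <= X]mul1r -[X in _ <= X * _](expr1n _ k).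
  under eq_bigr do rewrite (face_comp head_ladd).
  apply: (@ler_sum_map_lists R _ _ (head 0%N) _ _ 1 k ler01 _
    (fun t => nc (corrected (head 0%N y) - faceN t f (head 0%N y)))).
    move=> g g0; rewrite mul1r big_shifts /box /=.
    apply: (@le_trans _ _ (\sum_(x <- iota 0 K) g x)).
      by apply: ler_sum => x _; rewrite big_lists0.
    apply: ler_sum_subset => //; first exact: iota_uniq.
    by move=> x; rewrite !mem_iota; lia.
  by move=> *; apply: nc_ge0.
pose E u r := nc (lcube n corrected u - face ladd r (lcube n f) u).
have E0 u r : 0 <= E u r by apply: nc_ge0.
have sc u : size u = n.+2 -> size (contract0 u) = n.+1 /\ size (contract1 u) = n.+1.
  by move=> su; rewrite /= !size_behead su.
have [sy0 sy1] := sc _ sy.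
have sumc : (sumn (contract0 y) < H)%N /\ (sumn (contract1 y) < H)%N.
  by case: y sy yH {sc sy0 sy1} => [|a [|b s]] //=; lia.
have le1 : \sum_(r <- lists k (shifts n.+1 K))
    nc (lcube n.+1 corrected y - face ladd r (lcube n.+1 f) y) <=
  H%:R ^+ k * \sum_(r <- lists k (shifts n (K + H))) E (contract0 y) r +
  H%:R ^+ k * \sum_(r <- lists k (shifts n (K + H))) E (contract1 y) r.
  apply: (@le_trans _ _ (\sum_(r <- lists k (shifts n.+1 K))
    (E (contract0 y) (map contract0 r) + E (contract1 y) (map contract1 r)))).
    apply: ler_sum => r _ /=.
    rewrite faceM faceJ (face_comp contract0_ladd) (face_comp contract1_ladd).
    apply: le_trans (nc_mulBmul _ _ _ _) _; rewrite ?nc_JB ?ncJ //.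
      by apply: nc_lcube_le1; apply: nc_corrected_le1.
    by apply: nc_face_le1 => ?; apply: nc_lcube_le1.
  rewrite big_split /=; apply: lerD.
    by apply: (@ler_sum_map_lists R _ _ contract0 _ _ H%:R k (ler0n _ _) _
      (E (contract0 y))) => // g g0; apply: sum_contract0.
  by apply: (@ler_sum_map_lists R _ _ contract1 _ _ H%:R k (ler0n _ _) _
    (E (contract1 y))) => // g g0; apply: sum_contract1.
apply: le_trans (ler_wpM2l (ltW T0) le1) _.
have KT' : (K + H + n * H <= T)%N by lia.
have h0 := IH (K + H)%N _ sy0 sumc.1 KT'.
have h1 := IH (K + H)%N _ sy1 sumc.2 KT'.
rewrite mulrDr ![T%:R * (_ * _)]mulrCA -mulrDr.
apply: (@le_trans _ _ (H%:R ^+ k * ((2 * H%:R ^+ k) ^+ n * (k%:R * (6 * S)) +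
   (2 * H%:R ^+ k) ^+ n * (k%:R * (6 * S))))).
  by rewrite ler_wpM2l ?exprn_ge0 ?ler0n // lerD.
by rewrite exprS; lra.
Qed.

Lemma shiftsP d n : d \in shifts n H -> size d = n.+1 /\ (sumn d < n.+1 * H)%N.
Proof.
move=> dd; suff db : d \in box n.+1 H.
  by rewrite (sumn_box_lt H0 db); move: db; rewrite mem_box => /andP[/eqP].
exact: dd.
Qed.

Lemma size_shifts : size (shifts k H) = (H ^ k.+1)%N.
Proof. by rewrite size_allpairs size_iota size_box expnS. Qed.

(** Compare the cube of [corrected] with a face, in directions [r], of the function [lcube k f] on
    codes. That face is a product of generic cubes of [f], so it is close to 1 on average over [r]
    for every cube [y]. The 7 is 1 for this face plus 6 for the comparison. *)
Lemma cube_corrected x hs : size hs = k -> (x + sumn hs < H)%N ->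
  H%:R ^+ k.+1 * nc (1 - cubeN hs corrected x) <= 7 * k%:R * 2 ^+ k * S.
Proof.
move=> shs xH; set Lm := H%:R ^+ k.+1.
have Hr : (0 : R) < H%:R by rewrite ltr0n.
have Lm0 : 0 < Lm by rewrite exprn_gt0.
pose y := x :: hs; have sy : size y = k.+1 by rewrite /= shs.
(* A shift has total less than [(k + 1) * H]; [m.+1] of them are reserved because the averaging
   variable uses one itself. *)
pose P m (z : seq nat) := size z = k.+1 /\ (sumn z + m.+1 * (k.+1 * H) <= N)%N.
have := @sum_1Bface _ ladd (lcube k f) (shifts k H) S P laddAC
  (fun u => nc_lcube_le1 _ _ f1) _ _ _ k y.
rewrite size_shifts natrX -/Lm => H1.
have {}H1 : Lm * \sum_(r <- lists k (shifts k H))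
    nc (1 - face ladd r (lcube k f) y) <= k%:R * 2 ^+ k * Lm ^+ k * S.
  apply: H1.
  - by move=> m z [sz zN]; split => //; lia.
  - move=> m z d [sz zN] /shiftsP[sd dH]; split; last by rewrite sumn_ladd; lia.
    by rewrite size_ladd sd.
  - move=> z [sz zN]; apply: le_trans sumS.
    apply: (@le_trans _ _ (\sum_(d <- shifts k H) defect f (ladd z d))).
      apply: ler_sum_in => d /shiftsP[sd dH].
      have : size (ladd z d) = k.+1 by rewrite size_ladd sd.
      by case: (ladd z d) => //= a s [<-]; rewrite /defect -lcubeE.
    apply: sum_cubes_translate => //; first exact: defect_ge0.
      by apply: uniq_box k.+1 H.
    by move=> d /shiftsP[sd dH]; split => //; lia.
  - by split => //=; move: HN xH; nia.
have HT : (H + k * H <= T)%N by rewrite /T; lia.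
have H2 := sum_lcube_corrected sy xH HT.
have H3 : Lm ^+ k * nc (1 - cubeN hs corrected x) <=
   \sum_(r <- lists k (shifts k H)) nc (1 - face ladd r (lcube k f) y) +
   \sum_(r <- lists k (shifts k H))
      nc (lcube k corrected y - face ladd r (lcube k f) y).
  rewrite -big_split /=.
  have -> : Lm ^+ k * nc (1 - cubeN hs corrected x) =
     \sum_(r <- lists k (shifts k H)) nc (1 - cubeN hs corrected x).
    by rewrite sum_const_seq size_lists size_shifts !natrX.
  apply: ler_sum => r _; rewrite [X in _ <= _ + X]ncB -lcubeE shs.
  exact: nc_triangle.
set s1 := \sum_(r <- _) _ in H1 H3; set s2 := \sum_(r <- _) _ in H2 H3.
have s20 : 0 <= s2 by apply: sumr_ge0 => *; apply: nc_ge0.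
have H4 : Lm * s2 <= 2 ^+ k * Lm ^+ k * (k%:R * (6 * S)).
  apply: (@le_trans _ _ (H%:R ^+ k * (T%:R * s2))).
    rewrite /Lm exprSr -mulrA ler_wpM2l ?exprn_ge0 ?ler0n // ler_wpM2r //.
    by rewrite ler_nat /T; nia.
  apply: le_trans (ler_wpM2l (exprn_ge0 _ (ltW Hr)) H2) _.
  by rewrite exprMn /Lm -!exprM mulSn exprD; lra.
rewrite -(ler_pM2l (exprn_gt0 k Lm0)) mulrCA.
apply: le_trans (ler_wpM2l (ltW Lm0) H3) _.
by rewrite mulrDr; lra.
Qed.

(** Compare through a prediction [faceN t f x]. The distance from [f x] to it is a defect of a cube
    based at [x], which is controlled only after summing over [x]: hence an L1 bound, unlike for the
    cubes of [corrected]. *)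
Lemma sum_f_corrected :
  H%:R ^+ k * \sum_(x <- iota 0 H) nc (f x - corrected x) <= (6 * k%:R + 3) * S.
Proof.
have Hr : (0 : R) < H%:R by rewrite ltr0n.
have HT : (H <= T)%N by rewrite /T; nia.
apply: (@le_trans _ _ (T%:R ^+ k * \sum_(x <- iota 0 H) nc (f x - corrected x))).
  apply: ler_wpM2r; first by apply: sumr_ge0 => *; apply: nc_ge0.
  by rewrite lerXn2r ?nnegrE ?ler0n ?ler_nat.
apply: (@le_trans _ _ (\sum_(x <- iota 0 H) \sum_(t <- box k T)
   (3 * defect f (x :: t) + nc (corrected x - faceN t f x)))).
  rewrite mulr_sumr; apply: ler_sum => x _.
  have -> : T%:R ^+ k * nc (f x - corrected x) =
     \sum_(t <- box k T) nc (f x - corrected x).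
    by rewrite sum_const_seq size_box natrX.
  apply: ler_sum => t _; apply: le_trans (nc_triangle (faceN t f x) _ _) _.
  rewrite ncB [X in _ + X]ncB lerD2r ncB /defect /= (cubeE addn).
  by rewrite nc_1BmulJ // nc_face_le1.
under eq_bigr do rewrite big_split /=.
rewrite big_split /= mulrDl addrC; apply: lerD.
  apply: (@le_trans _ _ (\sum_(x <- iota 0 H) T%:R^-1 * (k%:R * (6 * S)))).
    apply: ler_sum_in => x; rewrite mem_iota add0n => xH.
    by rewrite -(ler_pM2l T0) [X in _ <= X]mulrA mulfV ?gt_eqF // mul1r sum_face_corrected.
  rewrite sum_const_seq size_iota [X in X <= _]mulrA.
  have -> : 6 * k%:R * S = 1 * (k%:R * (6 * S)) by ring.
  rewrite ler_wpM2r ?mulr_ge0 ?ler0n //.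
  by rewrite ler_pdivrMr // mul1r ler_nat.
under eq_bigr do rewrite -mulr_sumr.
rewrite -mulr_sumr ler_pM2l ?ltr0n //; apply: le_trans sumS.
rewrite -(big_allpairs_dep (h := fun x t => x :: t) (r1 := iota 0 H)
  (r2 := fun=> box k T) (F := defect f)).
apply: ler_sum_subset.
- apply: allpairs_uniq; rewrite ?uniq_box ?iota_uniq //.
  by move=> [a s] [b t] _ _ /= [-> ->].
- move=> u /allpairsP[[x t] /= [xH tT ->]].
  rewrite mem_cubes /=; move: (sumn_box tT) xH; move: tT; rewrite mem_box mem_iota.
  by case/andP=> /eqP -> _; rewrite eqxx /=; move: HN; rewrite /T; nia.
- by move=> u; apply: defect_ge0.
Qed.

End SelfCorrection.

(** * Hyers-Ulam stability of polynomials *)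

Section Differences.
Variable R : realType.

Section Generic.
Variables (A : Type) (add : A -> A -> A).

(** The sign, value at [x] minus value at [x + h], is that of [cube], so that [e] turns one into the
    other. *)
Fixpoint ddiff (hs : seq A) (f : A -> R) (x : A) : R :=
  if hs is h :: hs' then ddiff hs' f x - ddiff hs' f (add x h) else f x.

Lemma ddiff_insert a h b f x :
  (forall x y z, add (add x y) z = add (add x z) y) ->
  ddiff (a ++ h :: b) f x = ddiff (a ++ b) f x - ddiff (a ++ b) f (add x h).
Proof.
move=> addAC; elim: a x => [|u a IH] x //=.
by rewrite !IH addAC; ring.
Qed.

Lemma eq_ddiff hs f g : f =1 g -> ddiff hs f =1 ddiff hs g.
Proof. by move=> fg; elim: hs => [|h hs IH] x //=; rewrite !IH. Qed.

Lemma ddiffD hs f g x :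
  ddiff hs (fun y => f y + g y) x = ddiff hs f x + ddiff hs g x.
Proof. by elim: hs x => [|h hs IH] x //=; rewrite !IH; ring. Qed.

Lemma ddiffZ hs c f x : ddiff hs (fun y => c * f y) x = c * ddiff hs f x.
Proof. by elim: hs x => [|h hs IH] x //=; rewrite !IH; ring. Qed.

Lemma ddiff0 hs x : ddiff hs (fun=> 0) x = 0.
Proof. by elim: hs x => [|h hs IH] x //=; rewrite !IH subrr. Qed.

Lemma ddiff_sum (I : Type) (s : seq I) hs (F : I -> A -> R) x :
  ddiff hs (fun y => \sum_(i <- s) F i y) x = \sum_(i <- s) ddiff hs (F i) x.
Proof.
elim: s => [|i s IH].
  rewrite big_nil -[RHS](ddiff0 hs x); apply: eq_ddiff => y.
  by rewrite big_nil.
rewrite big_cons -IH -ddiffD; apply: eq_ddiff => y.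
by rewrite big_cons.
Qed.

Lemma ddiff_int hs f x : (forall y, f y \is a Num.int) ->
  ddiff hs f x \is a Num.int.
Proof. by move=> fi; elim: hs x => [|h hs IH] x //=; rewrite rpredB. Qed.

End Generic.

Lemma ddiff_comp (A B : Type) (add : A -> A -> A) (add' : B -> B -> B)
    (p q : A -> B) hs (f : B -> R) x :
  (forall x h, p (add x h) = add' (p x) (q h)) ->
  ddiff add hs (fun y => f (p y)) x = ddiff add' (map q hs) f (p x).
Proof. by move=> pq; elim: hs x => [|h hs IH] x //=; rewrite !IH pq. Qed.

(** By the binomial formula, one difference in direction [h] lowers the degree by one and multiplies
    the leading coefficient by -m h; the remaining terms have too low a degree to survive. *)
Lemma ddiff_expr (hs : seq R) m x : (m <= size hs)%N ->
  ddiff +%R hs (fun y => y ^+ m) x =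
  if m == size hs then (-1) ^+ m * m`!%:R * \prod_(h <- hs) h else 0.
Proof.
elim: hs m x => [|h hs IH] m x /=.
  by rewrite leqn0 => /eqP ->; rewrite big_nil !mulr1.
move=> mh.
have -> : ddiff +%R hs (fun y => y ^+ m) (x + h) =
    \sum_(i < m.+1) h ^+ (m - i) *+ 'C(m, i) * ddiff +%R hs (fun y => y ^+ i) x.
  transitivity (ddiff +%R hs (fun y => (y + h) ^+ m) x).
    rewrite (@ddiff_comp _ _ +%R +%R (fun y => y + h) id hs (fun y => y ^+ m)).
      by rewrite map_id.
    by move=> y z; rewrite addrAC.
  rewrite -[index_enum _]/(index_enum _).
  under eq_bigr do rewrite -ddiffZ.
  rewrite -ddiff_sum; apply: eq_ddiff => y.
  rewrite addrC exprDn; apply: eq_bigr => i _.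
  by rewrite -mulrnAl.
rewrite big_ord_recr /= subnn binn mul1r opprD addrCA subrr addr0.
case: m mh => [|m] mh.
  by rewrite big_ord0 oppr0.
rewrite eqSS; case: eqVneq => [mE|nm].
  rewrite big_ord_recr /= big1 ?add0r => [|i _].
    rewrite IH ?mE // eqxx big_cons subSnn binSn expr1 factS natrM exprS -mE.
    by rewrite -mulr_natr; ring.
  rewrite IH; last by move: (ltn_ord i); lia.
  by rewrite ltn_eqF ?mulr0 // -mE.
rewrite big1 ?oppr0 // => i _; rewrite IH; last by move: (ltn_ord i); lia.
rewrite ltn_eqF ?mulr0 //; move: (ltn_ord i); lia.
Qed.

Lemma ddiff_poly (p : {poly R}) (hs : seq R) x : (size p <= size hs)%N ->
  ddiff +%R hs (horner p) x = 0.
Proof.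
move=> sp; rewrite (eq_ddiff _ _ (fun y => horner_coef p y)) ddiff_sum.
rewrite big1 // => i _; rewrite ddiffZ ddiff_expr.
  by rewrite ltn_eqF ?mulr0 // (leq_trans (ltn_ord i)).
by rewrite ltnW // (leq_trans (ltn_ord i)).
Qed.

Lemma ddiff_poly_nat (p : {poly R}) (hs : seq nat) x : (size p <= size hs)%N ->
  ddiff addn hs (fun n => p.[n%:R]) x = 0.
Proof.
move=> sp; rewrite (@ddiff_comp _ _ addn +%R (fun n => n%:R) (fun n => n%:R)).
  by rewrite ddiff_poly // size_map.
by move=> y h; rewrite natrD.
Qed.

Lemma ddiff_nat_ext hs (f g : nat -> R) x :
  (forall y, (x <= y <= x + sumn hs)%N -> f y = g y) ->
  ddiff addn hs f x = ddiff addn hs g x.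
Proof.
elim: hs x => [|h hs IH] x fg /=; first by apply: fg => /=; lia.
by congr (_ - _); apply: IH => y yx; apply: fg => /=; lia.
Qed.

(** Positive directions make the top vertex the only one at its position. A value there can then be
    adjusted, or solved for, without touching other vertices. *)
Lemma ddiff_top hs (c : R) x : all (leq 1) hs ->
  ddiff addn hs (fun y => if y == (x + sumn hs)%N then c else 0) x =
  (-1) ^+ size hs * c.
Proof.
elim: hs x => [|h hs IH] x /=; first by rewrite addn0 eqxx mul1r.
case/andP=> h1 hs1; rewrite addnA IH // exprS.
rewrite (@ddiff_nat_ext _ _ (fun=> 0)) ?ddiff0; first by ring.
by move=> y /andP[_ yx]; rewrite ltn_eqF //; lia.
Qed.

(** Subtract the linear map agreeing with [a] at [L], and let [i] maximise the absolute value of the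
    rest [b]. If 2i <= L, doubling gives |b i| <= d. Otherwise b i is within d of -b (L - i), and
    doubling at L - i gives |b i| <= d + (d + |b i|) / 2. *)
Lemma approx_additive (a : nat -> R) (L : nat) (d : R) :
  (0 < L)%N ->
  (forall h h', (h + h' <= L)%N -> `|a (h + h')%N - a h - a h'| <= d) ->
  forall h, (h <= L)%N -> `|a h - h%:R / L%:R * a L| <= 3 * d.
Proof.
move=> L0 ha h hL; have Lr : (L%:R : R) != 0 by rewrite pnatr_eq0 -lt0n.
pose b n := a n - n%:R / L%:R * a L.
have bL : b L = 0 by rewrite /b mulfV // mul1r subrr.
have hb n n' : (n + n' <= L)%N -> `|b (n + n')%N - b n - b n'| <= d.
  move=> /ha; congr (`|_| <= d); rewrite /b natrD; ring.
have [i _ imax] := @Order.TotalTheory.arg_maxP _ _ 'I_L.+1 ord0 xpredT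
  (fun i => `|b i|) isT.
suff : `|b i| <= 3 * d.
  apply: le_trans; have hL' : (h < L.+1)%N by [].
  by apply: (imax (Ordinal hL')).
have bmax n : (n <= L)%N -> `|b n| <= `|b i|.
  by rewrite -ltnS => nL; apply: (imax (Ordinal nL)).
have d0 : 0 <= d by apply: le_trans (hb 0%N 0%N _).
have iL : (i <= L)%N by rewrite -ltnS.
have dbl n : (n + n <= L)%N -> 2 * `|b n| <= d + `|b i|.
  move=> nL; have := hb _ _ nL; have := bmax _ nL.
  have -> : 2 * `|b n| = `|2 * b n| by rewrite normrM ger0_norm.
  move=> h1 h2; have -> : 2 * b n = b (n + n)%N - (b (n + n)%N - b n - b n) by ring.
  by apply: le_trans (ler_normB _ _) _; lra.
have [iL2|iL2] := leqP (i + i)%N L; first by have := dbl _ iL2; lra.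
have := hb i (L - i)%N; rewrite subnKC // bL => /(_ (leqnn _)) h1.
have h2 : `|b i| <= `|b (L - i)%N| + d.
  have -> : b i = - b (L - i)%N - (0 - b i - b (L - i)%N) by ring.
  by apply: le_trans (ler_normB _ _) _; rewrite normrN lerD2l.
have h3 : 2 * `|b (L - i)%N| <= d + `|b i| by apply: dbl; lia.
lra.
Qed.

Fixpoint hyers_cst (k : nat) : R :=
  if k is k'.+1 then (3 * k'%:R + 1) * hyers_cst k' else 1.

Lemma hyers_cst_ge0 k : 0 <= hyers_cst k.
Proof.
by elim: k => [|k IH] /=; rewrite ?ler01 // mulr_ge0 // addr_ge0 ?mulr_ge0.
Qed.

(* The approximate multilinearity of the k-th differences produces the
   coefficient of degree k; this costs a factor k + 1 in the length of the
   interval. *)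
Lemma hyers_real k m (f : nat -> R) (d : R) : 0 <= d ->
  (forall hs x, size hs = k -> (x + sumn hs < k`! * m)%N ->
     `|ddiff addn hs f x| <= d) ->
  exists2 p : {poly R}, (size p <= k)%N &
    forall x, (x < m)%N -> `|f x - p.[x%:R]| <= hyers_cst k * d.
Proof.
elim: k f d => [|k IH] f d d0 hf.
  exists 0; first by rewrite size_poly0.
  by move=> x xm; rewrite horner0 subr0 mul1r; apply: (hf [::] x) => //; rewrite fact0 mul1n addn0.
case: (posnP m) => [m0|m0]; first by exists 0; rewrite ?size_poly0 // => x; rewrite m0.
pose L := (k`! * m)%N; have L0 : (0 < L)%N by rewrite muln_gt0 fact_gt0.
have Lr : (L%:R : R) != 0 by rewrite pnatr_eq0 -lt0n.
rewrite factS -mulnA -/L in hf.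
pose D0 := ddiff addn (nseq k L) f 0.
(* Directions equal to [L] are exchanged one at a time for arbitrary ones; each exchange costs
   [3 * d] by [approx_additive]. *)
have multi i j b : (i + j)%N = k -> size b = j -> all (fun h => h <= L)%N b ->
    `|ddiff addn (nseq i L ++ b) f 0 - (\prod_(h <- b) (h%:R / L%:R)) * D0|
    <= 3 * j%:R * d.
  elim: j i b => [|j IHj] i b; rewrite ?addn0.
    by move=> -> /size0nil -> _; rewrite cats0 big_nil mul1r subrr normr0 mulr0 mul0r.
  case: b => // h b ijk [sb] /= /andP[hL bL].
  have IHb := IHj i.+1 b _ sb bL; rewrite addSnnS in IHb; have {}IHb := IHb ijk.
  have := @approx_additive (fun h => ddiff addn (nseq i L ++ h :: b) f 0) L d L0 _ h hL.
  have -> : nseq i L ++ L :: b = nseq i.+1 L ++ b by elim: (i) => //= n ->.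
  have sumb : (sumn b <= j * L)%N.
    by rewrite -sb; elim: (b) bL => //= y s IHs /andP[yL /IHs]; lia.
  (* The failure of additivity in one direction is, up to sign, a difference with both [h1] and
     [h2], hence of order k + 1. *)
  have H1 h1 h2 : (h1 + h2 <= L)%N ->
     `|ddiff addn (nseq i L ++ (h1 + h2)%N :: b) f 0 - ddiff addn (nseq i L ++ h1 :: b) f 0 -
       ddiff addn (nseq i L ++ h2 :: b) f 0| <= d.
    move=> h12; rewrite -normrN.
    have s1 : size (nseq i L ++ h1 :: h2 :: b) = k.+1.
      by rewrite size_cat size_nseq /= sb; lia.
    have s2 : (0 + sumn (nseq i L ++ h1 :: h2 :: b) < k.+1 * L)%N.
      by rewrite sumn_cat sumn_nseq /=; nia.
    have := hf _ _ s1 s2; rewrite !(ddiff_insert _ _ _ _ _ addnAC) !add0n.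
    by congr (`|_| <= _); ring.
  move=> /(_ H1) h2.
  rewrite big_cons; set P := \prod_(i <- b) _ in IHb *.
  set X := ddiff addn (nseq i.+1 L ++ b) f 0 in IHb h2.
  have -> : forall Y, Y - h%:R / L%:R * P * D0 =
     (Y - h%:R / L%:R * X) + h%:R / L%:R * (X - P * D0) by move=> Y; ring.
  apply: le_trans (ler_normD _ _) _.
  have -> : 3 * j.+1%:R * d = 3 * d + 3 * j%:R * d by rewrite -natr1; ring.
  rewrite lerD // normrM; apply: le_trans IHb.
  rewrite ler_piMl // ger0_norm ?divr_ge0 ?ler0n //.
  by rewrite ler_pdivrMr ?ltr0n // mul1r ler_nat.
(* Normalised so that the k-th difference of [c * y ^ k] in directions all equal to [L] is [D0]. *)
pose c := (-1) ^+ k / (k`!%:R * L%:R ^+ k) * D0.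
have kL : (k`!%:R : R) != 0 by rewrite pnatr_eq0 -lt0n fact_gt0.
have dc hs x : size hs = k -> ddiff addn hs (fun y => c * y%:R ^+ k) x =
    (\prod_(h <- hs) (h%:R / L%:R)) * D0.
  move=> shs; rewrite ddiffZ.
  rewrite (@ddiff_comp _ _ addn +%R (fun n => n%:R) (fun n => n%:R) _ (fun y => y ^+ k)); last first.
    by move=> *; rewrite natrD.
  rewrite ddiff_expr size_map shs // eqxx big_map big_split /=.
  have -> : \prod_(i <- hs) (L%:R : R)^-1 = L%:R ^- k.
    by rewrite big_const_seq count_predT shs iter_mulr_1 exprVn.
  rewrite /c; have s1 : (-1) ^+ k * (-1) ^+ k = 1 :> R by rewrite -exprMn mulrNN mul1r expr1n.
  transitivity (((-1) ^+ k * (-1) ^+ k) * (\prod_(i <- hs) i%:R / L%:R ^+ k * D0)).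
    by field; rewrite kL expf_neq0.
  by rewrite s1 mul1r.
(* The part [3 * k * d] is the error of [multi] at base point 0; the extra [d] moves the base point
   to [x], again by a difference of order k + 1. *)
have := IH (fun y => f y - c * y%:R ^+ k) ((3 * k%:R + 1) * d) _ _.
case=> [||p sp hp].
- by rewrite mulr_ge0 // addr_ge0 ?mulr_ge0.
- move=> hs x shs xL.
  have -> : ddiff addn hs (fun y => f y - c * y%:R ^+ k) x =
      ddiff addn hs f x - (\prod_(h <- hs) (h%:R / L%:R)) * D0.
    rewrite -(dc hs x shs) -mulN1r -ddiffZ -ddiffD; apply: eq_ddiff => y.
    by rewrite mulN1r.
  have h1 := multi 0%N k hs (add0n _) shs _; rewrite cat0s in h1.
  have h2 := hf (x :: hs) 0%N _ _; rewrite /= add0n in h2.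
  have -> : forall P, ddiff addn hs f x - P =
     (ddiff addn hs f 0 - P) - (ddiff addn hs f 0 - ddiff addn hs f x) by move=> P; ring.
  apply: le_trans (ler_normB _ _) _; rewrite mulrDl mul1r lerD //.
    apply: h1; apply/allP => y ys; have := perm_sumn (perm_to_rem ys) => /=; lia.
  by apply: h2; rewrite ?shs //; nia.
exists (p + c *: 'X^k).
  rewrite (leq_trans (size_polyD _ _)) // geq_max (leq_trans sp) //=.
  by rewrite (leq_trans (size_scale_leq _ _)) // size_polyXn.
move=> x xm; rewrite hornerD hornerZ hornerXn.
have := hp x xm => /=; rewrite mulrCA mulrA; congr (`|_| <= _); ring.
Qed.

End Differences.

(** * Lifting functions modulo 1 to the reals *)

Section Lifting.
Variable R : realType.
Implicit Types (f g : nat -> R).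

Definition near_int (d x : R) := exists2 z : R, z \is a Num.int & `|x - z| <= d.

Definition eq_mod1 f g := forall x, g x - f x \is a Num.int.

Lemma near_int_mod1 d f g hs x : eq_mod1 f g ->
  near_int d (ddiff addn hs f x) -> near_int d (ddiff addn hs g x).
Proof.
move=> fg [z zi zd].
exists (z + ddiff addn hs (fun y => g y - f y) x).
  by rewrite rpredD // ddiff_int.
suff -> : ddiff addn hs g x = ddiff addn hs f x + ddiff addn hs (fun y => g y - f y) x.
  by rewrite opprD addrACA subrr addr0.
by rewrite -ddiffD; apply: eq_ddiff => y; rewrite addrC subrK.
Qed.

Lemma int_lt1_eq0 (z : R) : z \is a Num.int -> `|z| < 1 -> z = 0.
Proof.
move=> zi z1; apply/eqP; apply: contraTT z1 => z0.
by rewrite -leNgt norm_intr_ge1.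
Qed.

Lemma near_int_small d x : near_int d x -> `|x| <= 2 * d -> 3 * d < 1 -> `|x| <= d.
Proof.
move=> [z zi zd] xd d1; suff z0 : z = 0 by rewrite z0 subr0 in zd.
apply: int_lt1_eq0 => //; apply: le_lt_trans d1.
have -> : z = x - (x - z) by ring.
by apply: le_trans (ler_normB _ _) _; lra.
Qed.

(** The lift is built point by point: with unit directions, [n] is the top vertex of just one new
    difference, so an integer added to the value at [n] brings that difference near 0 and leaves the
    earlier ones unchanged. *)
Lemma lift_ones k n f d :
  (forall x, (x + k < n)%N -> near_int d (ddiff addn (nseq k 1%N) f x)) ->
  exists2 g, eq_mod1 f g &
    forall x, (x + k < n)%N -> `|ddiff addn (nseq k 1%N) g x| <= d.
Proof.
elim: n => [|n IH] hf; first by exists f => // x; rewrite subrr.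
have [|g fg hg] := IH; first by move=> x xn; apply: hf; lia.
have [kn|nk] := leqP k n; last by exists g => // x; lia.
have snk : sumn (nseq k 1%N) = k by rewrite sumn_nseq mul1n.
have [z zi zd] : near_int d (ddiff addn (nseq k 1%N) g (n - k)%N).
  by apply: (near_int_mod1 fg); apply: hf; lia.
pose c := - ((-1) ^+ k * z).
exists (fun y => g y + (if y == n then c else 0)) => [y|x].
  rewrite addrAC rpredD //; case: eqP => _; last exact: rpred0.
  by rewrite /c rpredN rpredM // rpredX // rpredN rpred1.
rewrite ltnS ddiffD leq_eqVlt => /predU1P[xk|xk].
  have xE : x = (n - k)%N by lia.
  have -> : n = (x + sumn (nseq k 1%N))%N by rewrite snk.
  rewrite ddiff_top; last by elim: (k).
  rewrite size_nseq /c mulrN mulrA -exprMn mulrNN mul1r expr1n mul1r.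
  by rewrite xE.
rewrite (@ddiff_nat_ext _ _ (fun y => if y == n then c else 0) (fun=> 0)).
  by rewrite ddiff0 addr0; apply: hg.
by move=> y /andP[_]; rewrite snk => yx; rewrite ltn_eqF //; lia.
Qed.

(* Enlarging one direction by 1 keeps the difference of absolute value at most
   [2 d], hence at most [d] since it is within [d] of an integer. *)
Lemma lift_all k n g d : 3 * d < 1 -> 0 <= d ->
  (forall hs x, size hs = k -> (x + sumn hs < n)%N ->
     near_int d (ddiff addn hs g x)) ->
  (forall x, (x + k < n)%N -> `|ddiff addn (nseq k 1%N) g x| <= d) ->
  forall hs x, size hs = k -> (x + sumn hs < n)%N -> `|ddiff addn hs g x| <= d.
Proof.
move=> d1 d0 near ones.
suff H i a x : (size a + i)%N = k -> (x + sumn a + i < n)%N ->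
    `|ddiff addn (a ++ nseq i 1%N) g x| <= d.
  by move=> hs x shs xn; have := H 0%N hs x; rewrite /= cats0 !addn0; apply.
elim/last_ind: a i x => [|a h IH] i x.
  by rewrite add0n => -> xn; apply: ones; rewrite addn0 in xn.
rewrite size_rcons -cats1 -catA sumn_cat /= addn0 => sa.
have step y : (y + sumn a + i.+1 < n)%N ->
    `|ddiff addn (a ++ 1%N :: nseq i 1%N) g y| <= d.
  by move=> yn; apply: (IH i.+1) => //; rewrite -sa addSnnS.
elim: h x => [|h IHh] x xn.
  by rewrite (ddiff_insert _ _ _ _ _ addnAC) addn0 subrr normr0.
apply: near_int_small d1.
  apply: near; first by rewrite size_cat /= size_nseq -sa addnS.
  by rewrite sumn_cat /= sumn_nseq; lia.
have -> : ddiff addn (a ++ h.+1 :: nseq i 1%N) g x =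
   ddiff addn (a ++ h :: nseq i 1%N) g x +
   ddiff addn (a ++ 1%N :: nseq i 1%N) g (x + h)%N.
  by rewrite !(ddiff_insert _ _ _ _ _ addnAC) addn1 addnS; ring.
apply: le_trans (ler_normD _ _) _; rewrite mulr_natl mulr2n lerD //.
  by apply: IHh; lia.
by apply: step; lia.
Qed.

Lemma hyers_mod1 k m f d : 3 * d < 1 -> 0 <= d ->
  (forall hs x, size hs = k -> (x + sumn hs < k`! * m)%N ->
     near_int d (ddiff addn hs f x)) ->
  exists (p : {poly R}) g, [/\ (size p <= k)%N, eq_mod1 f g &
    forall x, (x < m)%N -> `|g x - p.[x%:R]| <= hyers_cst R k * d].
Proof.
move=> d1 d0 hf.
have [|g fg hg] := @lift_ones k (k`! * m) f d.
  move=> x xn; apply: hf; first by rewrite size_nseq.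
  by rewrite sumn_nseq mul1n.
have [|p sp hp] := @hyers_real R k m g d d0.
  apply: lift_all => // hs x shs xn.
  by apply: (near_int_mod1 fg); apply: hf.
by exists p, g.
Qed.

End Lifting.

(** * The exponential and the distance to the integers *)

Section Phase.
Import numFieldNormedType.Exports.
Variable R : realType.
Implicit Types (x y : R).

Lemma eD x y : e (x + y) = e x * e y.
Proof.
rewrite /e mulrDr cosD sinD; apply/eqP; rewrite eq_complex /=.
by apply/andP; split; apply/eqP; ring.
Qed.

Lemma eN x : e (- x) = conjc (e x).
Proof. by rewrite /e mulrN cosN sinN. Qed.

Lemma e0 : e (0 : R) = 1.
Proof. by rewrite /e mulr0 cos0 sin0. Qed.

Lemma nc_e x : nc (e x) = 1.
Proof. by rewrite /e /ComplexField.Normc.normc cos2Dsin2 sqrtr1. Qed.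

Lemma e_int x : x \is a Num.int -> e x = 1.
Proof.
have enat n : e (n%:R : R) = 1.
  elim: n => [|n IH]; first exact: e0.
  rewrite -natr1 eD IH mul1r /e mulr1 mulr_natl.
  by rewrite cos2pi sin2pi.
move=> /intrP[[n|n] ->]; first exact: enat.
by rewrite NegzE mulrNz eN enat conjc1.
Qed.

Lemma e_mod1 x y : x - y \is a Num.int -> e x = e y.
Proof. by move=> /e_int xy; rewrite -[x](subrK y) eD xy mul1r. Qed.

Lemma e_surj (z : R[i]) : nc z = 1 -> exists x, e x = z.
Proof.
case: z => a b; rewrite /ComplexField.Normc.normc => h.
have h2 : a ^+ 2 + b ^+ 2 = 1.
  by rewrite -[LHS]sqr_sqrtr ?addr_ge0 ?sqr_ge0 // h expr1n.
have a1 : -1 <= a <= 1.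
  rewrite -ler_norml -(@ler_pXn2r _ 2) ?nnegrE // expr1n.
  by rewrite real_normK ?num_real // -h2 lerDl sqr_ge0.
have pi0 : (2 * pi : R) != 0 by rewrite mulf_neq0 // gt_eqF ?pi_gt0.
have ac := acosK (x := a); rewrite in_itv /= a1 in ac; have {}ac := ac isT.
have as_ : sin (acos a) = `|b|.
  rewrite sin_acos // -sqrtr_sqr; congr Num.sqrt; lra.
have [b0|b0] := leP 0 b.
  exists (acos a / (2 * pi)); rewrite /e mulrCA mulfV // mulr1 ac as_.
  by rewrite ger0_norm.
exists (- (acos a / (2 * pi))); rewrite eN /e mulrCA mulfV // mulr1 ac as_.
by rewrite ltr0_norm // /conjc opprK.
Qed.

Lemma nc_1Be x : nc (1 - e x) = 2 * `|sin (pi * x)|.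
Proof.
apply/eqP; rewrite -(@eqrXn2 _ 2) ?nc_ge0 ?mulr_ge0 // nc_sqr /=.
rewrite exprMn real_normK ?num_real // -mulrA mulr_natl.
have -> : (pi * x) *+ 2 = pi * x + pi * x by [].
rewrite cosD sinD; have := cos2Dsin2 (pi * x).
set c := cos _; set s := sin _ => cs.
have -> : 1 = c ^+ 2 + s ^+ 2 by [].
apply/eqP; transitivity (4 * s ^+ 2 * (c ^+ 2 + s ^+ 2)); first by ring.
by rewrite cs; ring.
Qed.

Lemma sin_MVT x : 0 <= x -> exists2 c, 0 <= c <= x & sin x = cos c * x.
Proof.
move=> x0; have [|c] := @MVT_segment R sin cos 0 x x0 (fun y _ => is_derive_sin y).
  exact/continuous_subspaceT/continuous_sin.
by rewrite in_itv /= sin0 !subr0 => cx sE; exists c.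
Qed.

Lemma norm_sin_le x : `|sin x| <= `|x|.
Proof.
have pos y : 0 <= y -> `|sin y| <= y.
  move=> y0; have [c _ ->] := sin_MVT y0.
  by rewrite normrM (ger0_norm y0) ler_piMl // cos_max.
have [x0|x0] := leP 0 x; first by rewrite (ger0_norm x0) pos.
by rewrite -normrN -sinN (ltr0_norm x0) pos // oppr_ge0 ltW.
Qed.

Lemma nc_eB x y : nc (e x - e y) <= 2 * pi * `|x - y|.
Proof.
have -> : e x - e y = - e y * (1 - e (x - y)).
  have -> : e x = e y * e (x - y) by rewrite -eD addrCA subrr addr0.
  by ring.
rewrite ncM ncN nc_e mul1r nc_1Be -mulrA ler_pM2l //.
by have := norm_sin_le (pi * (x - y)); rewrite normrM gtr0_norm // pi_gt0.
Qed.

(** Let [t] be [x] minus a nearest integer and y = pi |t|. Then 2 |sin y| <= d < 1 forces cos y >=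
    1/2, so the mean value theorem gives y <= 2 |sin y|. *)
Lemma near_int_e x d : nc (1 - e x) <= d -> d < 1 -> near_int d x.
Proof.
move=> xd d1; pose n : R := (Num.floor (x + 2^-1))%:~R.
have nint : n \is a Num.int by rewrite intr_int.
exists n => //; set t := x - n.
have et : e x = e t by apply: e_mod1; rewrite opprB addrCA subrr addr0.
rewrite et nc_1Be in xd.
have t2 : `|t| <= 2^-1.
  rewrite ler_norml /t /n.
  have := floor_le (x + 2^-1); have := floorD1_gt (x + 2^-1).
  by rewrite intrD /=; lra.
have xd' : 2 * `|sin (pi * `|t|)| <= d.
  have [t0|t0] := leP 0 t; first by rewrite (ger0_norm t0).
  by rewrite (ltr0_norm t0) mulrN sinN normrN.
set y := pi * `|t| in xd'.
have y0 : 0 <= y by rewrite mulr_ge0 // pi_ge0.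
have y2 : y <= pi / 2 by rewrite ler_pM2l ?pi_gt0.
have pi2 : pi / 2 <= pi :> R by rewrite ler_pdivrMr // ler_pMr ?pi_gt0 // ler1n.
have cy0 : 0 <= cos y by apply: cos_ge0_pihalf; rewrite y2 andbT (le_trans _ y0) // oppr_le0 divr_ge0 ?pi_ge0.
have s2 : `|sin y| < 2^-1 by lra.
have cy : 2^-1 <= cos y.
  rewrite -(@ler_pXn2r _ 2) ?nnegrE ?invr_ge0 // cos2sin2.
  have : `|sin y| ^+ 2 <= 2^-1 ^+ 2 by rewrite lerXn2r ?nnegrE ?invr_ge0 // ltW.
  rewrite real_normK ?num_real //; lra.
have [c /andP[c0 cyle] sE] := sin_MVT y0.
have cc : cos y <= cos c.
  move: cyle; rewrite le_eqVlt => /predU1P[-> //|cly].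
  by rewrite ltW // ltr_cos // in_itv /=; apply/andP; split; lra.
have : y <= 2 * `|sin y|.
  rewrite sE normrM (ger0_norm y0) mulrA ler_peMl //.
  have : cos c <= `|cos c| := ler_norm _; lra.
have : `|t| <= y by rewrite ler_peMl // (le_trans _ (pi_ge2 R)) // ler1n.
lra.
Qed.

End Phase.

(** * Extension to the whole interval *)

Section Core.
Variable R : realType.
Local Notation cubeN := (cube addn).

Lemma cube_e (A : Type) (add : A -> A -> A) hs (f : A -> R) x :
  cube add hs (fun y => e (f y)) x = e (ddiff add hs f x).
Proof. by elim: hs x => [|h hs IH] x //=; rewrite !IH -eN -eD. Qed.

Lemma polar (z : R[i]) : exists t, z = ((nc z)%:C)%C * e t.
Proof.
have [->|z0] := eqVneq z 0; first by exists 0; rewrite nc0 mul0r.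
have n0 : nc z != 0.
  by apply: contra z0 => /eqP/ComplexField.Normc.eq0_normc ->.
have [|t et] := @e_surj R (((nc z)^-1%:C)%C * z).
  by rewrite ncM nc_real ger0_norm ?invr_ge0 ?nc_ge0 // mulVf.
by exists t; rewrite et mulrA -rmorphM mulfV // rmorph1 mul1r.
Qed.

Lemma nc_cubeB hs (f g : nat -> R[i]) x d :
  (forall y, nc (f y) <= 1) -> (forall y, nc (g y) <= 1) ->
  (forall y, (y <= x + sumn hs)%N -> nc (f y - g y) <= d) ->
  nc (cubeN hs f x - cubeN hs g x) <= 2 ^+ size hs * d.
Proof.
move=> f1 g1; elim: hs x => [|h hs IH] x fg /=.
  by rewrite mul1r; apply: fg; lia.
apply: le_trans (nc_mulBmul _ _ _ _) _; rewrite ?ncJ ?nc_cube_le1 //.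
rewrite nc_JB exprS -mulrA mulr_natl mulr2n.
by apply: lerD; apply: IH => y yx; apply: fg => /=; lia.
Qed.

Definition core_cst k : R := 1 + 2 * pi * (hyers_cst R k * (1 + 2 ^+ k)).

Lemma phase_of_approx_cubes k m (g : nat -> R[i]) (d : R) : 0 <= d ->
  (forall y, nc (g y) <= 1) -> 3 * ((1 + 2 ^+ k) * d) < 1 ->
  (forall x hs, size hs = k -> (x + sumn hs < k`! * m)%N ->
     nc (1 - cubeN hs g x) <= d) ->
  exists2 p : {poly R}, (size p <= k)%N &
    forall x, (x < m)%N -> nc (g x - e p.[x%:R]) <= core_cst k * d.
Proof.
(* One [d] for the cube of [g], and [2 ^ k * d] for replacing [g] by its phase at the [2 ^ k]
   vertices. *)
move=> d0 g1 d1 hg; set d' := (1 + 2 ^+ k) * d in d1.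
have k2 : 0 <= (2 : R) ^+ k by rewrite exprn_ge0.
have d'0 : 0 <= d' by rewrite mulr_ge0 // addr_ge0.
have [phi hphi] := boolp.choice (fun x => polar (g x)).
(* The cube with all directions 0 lies in range for every such [x], and [g x] is a factor of it;
   hence |g x| >= 1 - d. *)
have gphi x : (x < k`! * m)%N -> nc (g x - e (phi x)) <= d.
  move=> xm; have sn : sumn (nseq k 0%N) = 0%N by rewrite sumn_nseq mul0n.
  have := hg x (nseq k 0%N); rewrite size_nseq sn addn0 => /(_ erefl xm) h.
  have -> : g x - e (phi x) = (((nc (g x) - 1)%:C)%C) * e (phi x).
    by rewrite {1}hphi rmorphB rmorph1 mulrBl mul1r.
  rewrite ncM nc_e mulr1 nc_real ler0_norm ?subr_le0 // opprB.
  apply: le_trans h; apply: le_trans (nc_1B_ge _).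
  rewrite lerD2l lerN2 cubeE ncM ncJ ler_piMr ?nc_ge0 //.
  exact: nc_face_le1.
have e1 y : nc (e (phi y)) <= 1 by rewrite nc_e.
have [|p [psi [sp psiE hp]]] := @hyers_mod1 R k m phi d' d1 d'0.
  move=> hs x shs xm; apply: near_int_e; last by lra.
  rewrite -cube_e; apply: le_trans (nc_triangle (cubeN hs g x) _ _) _.
  rewrite /d' mulrDl mul1r lerD ?hg // ncB.
  rewrite -shs; apply: nc_cubeB => // y yx.
  by rewrite ncB gphi // (leq_ltn_trans yx).
exists p => // x xm.
apply: le_trans (nc_triangle (e (phi x)) _ _) _.
rewrite /core_cst mulrDl mul1r lerD //.
  by apply: gphi; apply: leq_trans xm _; rewrite leq_pmull ?fact_gt0.
rewrite -(e_mod1 (psiE x)); apply: le_trans (nc_eB _ _) _.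
rewrite -[X in _ <= X]mulrA ler_wpM2l ?mulr_ge0 ?pi_ge0 //.
by rewrite -mulrA; apply: hp.
Qed.

Fixpoint offsets (hs : seq nat) : seq nat :=
  if hs is h :: hs' then offsets hs' ++ map (addn h) (offsets hs') else [:: 0%N].

(** All vertices but the top one, whereas [face] leaves out the bottom one. *)
Fixpoint proper_offsets (hs : seq nat) : seq nat :=
  if hs is h :: hs' then offsets hs' ++ map (addn h) (proper_offsets hs') else [::].

Lemma size_offsets hs : size (offsets hs) = (2 ^ size hs)%N.
Proof.
by elim: hs => //= h hs IH; rewrite size_cat size_map IH expnS mul2n addnn.
Qed.

Lemma size_proper_offsets hs : (size (proper_offsets hs) <= 2 ^ size hs)%N.
Proof.
elim: hs => //= h hs IH; rewrite size_cat size_map size_offsets.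
by rewrite expnS mul2n -addnn leq_add2l.
Qed.

Lemma offsets_le hs c : c \in offsets hs -> (c <= sumn hs)%N.
Proof.
elim: hs c => [|h hs IH] c /=; first by rewrite inE => /eqP ->.
rewrite mem_cat => /orP[/IH|/mapP[c' /IH c'h ->]]; lia.
Qed.

Lemma proper_offsets_le d hs c : all (leq d) hs -> c \in proper_offsets hs ->
  (c + d <= sumn hs)%N.
Proof.
elim: hs c => [|h hs IH] c //= /andP[dh dhs].
rewrite mem_cat => /orP[/offsets_le|/mapP[c' /(IH _ dhs) c'h ->]]; lia.
Qed.

Section Extension.
Variables (k : nat) (f : nat -> R[i]).
Hypothesis f1 : forall y, nc (f y) <= 1.

Let w y := nc (1 - f y).

Lemma nc_1Bcube_le hs x :
  nc (1 - cubeN hs f x) <= \sum_(c <- offsets hs) w (x + c)%N.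
Proof.
elim: hs x => [|h hs IH] x /=; first by rewrite big_seq1 addn0.
rewrite big_cat big_map /=; apply: le_trans (nc_1Bmul _ _) _.
  exact: nc_cube_le1.
rewrite nc_1BJ lerD //; apply: le_trans (IH _) _.
by apply: ler_sum => c _; rewrite addnA.
Qed.

(** Across the first direction, the lower facet is bounded by all its vertices, while the upper one
    is handled recursively. *)
Lemma nc_1Btop_le hs x : w (x + sumn hs)%N <=
  nc (1 - cubeN hs f x) + \sum_(c <- proper_offsets hs) w (x + c)%N.
Proof.
elim: hs x => [|h hs IH] x /=; first by rewrite big_nil addn0 addr0.
rewrite addnA; apply: le_trans (IH _) _.
rewrite big_cat big_map addrA /=; apply: lerD; last first.
  by apply: ler_sum => c _; rewrite addnA.
apply: le_trans (lerD (lexx _) (nc_1Bcube_le hs x)).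
set A := cubeN hs f x; set B := cubeN hs f (x + h)%N.
rewrite -(nc_1BJ B).
have -> : 1 - conjc B = (1 - A * conjc B) - (1 - A) * conjc B by ring.
apply: le_trans (nc_leB _ _) _; rewrite lerD2l ncM ncJ.
by rewrite ler_piMr ?nc_ge0 // nc_cube_le1.
Qed.

(** For [x] in [b, b'), average over cubes with top vertex [x] and directions in [d, 2d). Directions
    of at least [d] put all other vertices below [b]; their sum is at most [2 * k * d], so the base
    point is nonnegative. For each of at most [2 ^ k] lower vertices the position is injective in
    [x], and distinct pairs of [x] and directions give distinct cubes. *)
Lemma extend_step N d b b' (S : R) :
  \sum_(u <- cubes k N) defect f u <= S ->
  (0 < d)%N -> (2 * k * d <= b)%N -> (b <= b')%N -> (b' <= b + d)%N -> (b' <= N)%N ->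
  \sum_(x <- iota 0 b') w x <=
    (2 ^+ k + 1) * \sum_(x <- iota 0 b) w x + S / d%:R ^+ k.
Proof.
move=> sumS d0 kb bb' b'd b'N.
have w0 y : 0 <= w y by apply: nc_ge0.
have dk : (0 : R) < d%:R ^+ k by rewrite exprn_gt0 // ltr0n.
set E := \sum_(x <- iota 0 b) w x.
rewrite -(subnKC bb') iotaD big_cat /= -/E add0n mulrDl mul1r [2 ^+ k * E + E]addrC.
rewrite -addrA lerD2l.
pose D := lists k (iota d d).
have DP hs : hs \in D -> [/\ size hs = k, all (leq d) hs & (sumn hs <= b)%N].
  rewrite mem_lists => /andP[/eqP shs /allP hd]; split => //.
    by apply/allP => h /hd /=; rewrite mem_iota; lia.
  apply: leq_trans kb; rewrite -shs; elim: (hs) hd => //= h s IH hd.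
  have := hd h (mem_head _ _); rewrite /= mem_iota.
  suff : (sumn s <= 2 * size s * d)%N by nia.
  by apply: IH => y ys; apply: hd; rewrite inE ys orbT.
rewrite -(ler_pM2l dk) mulrDr [X in _ <= _ + X]mulrCA mulfV ?gt_eqF // mulr1.
have -> : d%:R ^+ k * \sum_(x <- iota b (b' - b)) w x =
   \sum_(hs <- D) \sum_(x <- iota b (b' - b)) w x.
  by rewrite sum_const_seq size_lists size_iota natrX.
apply: (@le_trans _ _ (\sum_(hs <- D) \sum_(x <- iota b (b' - b))
   (defect f ((x - sumn hs)%N :: hs) +
    \sum_(c <- proper_offsets hs) w (x - sumn hs + c)%N))).
  apply: ler_sum_in => hs /DP[shs _ hb]; apply: ler_sum_in => x.
  rewrite mem_iota => /andP[bx _].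
  rewrite -{1}(subnK (leq_trans hb bx)); exact: nc_1Btop_le.
under eq_bigr do rewrite big_split /=.
rewrite big_split /= addrC; apply: lerD.
  apply: (@le_trans _ _ (\sum_(hs <- D) 2 ^+ k * E)); last first.
    by rewrite sum_const_seq size_lists size_iota natrX.
  apply: ler_sum_in => hs /DP[shs dhs hb]; rewrite exchange_big /=.
  apply: (@le_trans _ _ (\sum_(c <- proper_offsets hs) E)).
    apply: ler_sum_in => c /(proper_offsets_le dhs) cd.
    apply: (ler_sum_inj (p := fun x => (x - sumn hs + c)%N)) => //.
    - exact: iota_uniq.
    - by move=> x y; rewrite !mem_iota; lia.
    - by move=> x; rewrite !mem_iota; lia.
  rewrite sum_const_seq ler_wpM2r ?sumr_ge0 // -natrX ler_nat -shs.
  exact: size_proper_offsets.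
apply: le_trans sumS.
rewrite -(big_allpairs_dep (h := fun hs x => (x - sumn hs)%N :: hs) (r1 := D)
  (r2 := fun=> iota b (b' - b)) (F := defect f)).
apply: ler_sum_subset.
- apply: allpairs_uniq_dep.
  + by rewrite uniq_lists ?iota_uniq.
  + by move=> hs _; apply: iota_uniq.
  move=> [hs x] [hs' x'] /allpairsPdep[a [y [/DP[_ _ ab] + [-> ->]]]].
  rewrite mem_iota => yb.
  move=> /allpairsPdep[a' [y' [/DP[_ _ ab'] + [-> ->]]]].
  by rewrite mem_iota => yb' /= [+ aa]; rewrite -aa in ab' *; move=> yy;
    congr existT; lia.
- move=> u /allpairsPdep[hs [x [/DP[shs _ hb] + ->]]].
  by rewrite mem_iota mem_cubes /= shs eqxx /=; lia.
- by move=> u; apply: defect_ge0.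
Qed.

Lemma extend_iter N d (S : R) j :
  \sum_(u <- cubes k N) defect f u <= S ->
  (0 < d)%N -> (2 * k * d <= N)%N ->
  \sum_(x <- iota 0 (minn N (2 * k * d + j * d))) w x <=
    (2 ^+ k + 1) ^+ j * (\sum_(x <- iota 0 (2 * k * d)) w x + j%:R * (S / d%:R ^+ k)).
Proof.
move=> sumS d0 kN; set E := \sum_(x <- iota 0 (2 * k * d)) w x.
set X := S / _; have S0 : 0 <= S.
  by apply: le_trans sumS; apply: sumr_ge0 => *; apply: defect_ge0.
have X0 : 0 <= X by rewrite divr_ge0 ?exprn_ge0.
have k2 : 0 <= (2 : R) ^+ k by rewrite exprn_ge0.
elim: j => [|j IH].
  by rewrite mul0n addn0 (minn_idPr kN) mul1r mul0r addr0.
have := @extend_step N d (minn N (2 * k * d + j * d))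
  (minn N (2 * k * d + j.+1 * d)) S sumS d0.
rewrite leq_min kN leq_addr => /(_ isT) H.
apply: le_trans (H _ _ _) _; [lia | lia | exact: geq_minl|].
apply: le_trans (lerD (ler_wpM2l _ IH) (lexx _)) _; first by rewrite addr_ge0.
rewrite -/X; set A := 2 ^+ k + 1.
have A1 : 1 <= A ^+ j.+1 by rewrite exprn_ege1 // lerDr.
have -> : A ^+ j.+1 * (E + j.+1%:R * X) =
    A * (A ^+ j * (E + j%:R * X)) + A ^+ j.+1 * X.
  by rewrite exprS -natr1; ring.
by rewrite lerD2l ler_peMl.
Qed.

End Extension.
End Core.

(** * The inverse theorem in terms of cube defects *)

Section Inverse.
Variable R : realType.

Lemma cube_mul_phase k (f : nat -> R[i]) (p : {poly R}) hs x :
  (size p <= k)%N -> size hs = k ->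
  cube addn hs (fun y => f y * e (- p.[y%:R])) x = cube addn hs f x.
Proof.
move=> sp shs; rewrite cubeM.
rewrite (cube_e addn hs (fun y : nat => - p.[y%:R])).
rewrite (eq_ddiff _ _ (g := fun y => (- p).[y%:R])).
  by rewrite ddiff_poly_nat ?e0 ?mulr1 // size_polyN shs.
by move=> y; rewrite hornerN.
Qed.

Lemma inverse_cubes (k : nat) : (1 <= k)%N -> exists (N0 : nat) (c0 K : R),
  [/\ (0 < N0)%N, 0 < c0, 0 <= K & forall N (f : nat -> R[i]) (s : R),
    (N0 <= N)%N -> (forall y, nc (f y) <= 1) -> 0 <= s -> s <= c0 ->
    \sum_(u <- cubes k N) defect f u <= s * N%:R ^+ k.+1 ->
    exists2 p : {poly R}, (size p <= k)%N &
      \sum_(x <- iota 0 N) nc (f x - e p.[x%:R]) <= K * s * N%:R].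
Proof.
(* With [d = N / C], the extension starts from length [2 * k * d]; Hyers-Ulam multiplies this by k!,
   and self-correction by [k.+2 ^ 2]. Taking [N0 = C] ensures d >= 1. *)
move=> k1; pose C := (k.+2 ^ 2 * (k`! * (2 * k)))%N.
have C0 : (0 < C)%N by rewrite !muln_gt0 /= fact_gt0 k1.
pose K2 : R := (2 * C%:R) ^+ k.+1.
have K20 : 0 <= K2 by rewrite exprn_ge0 // mulr_ge0.
have k2 : 0 <= (2 : R) ^+ k by rewrite exprn_ge0.
pose K1 : R := 7 * k%:R * 2 ^+ k * K2.
have K10 : 0 <= K1 by rewrite !mulr_ge0.
pose Q : R := 3 * ((1 + 2 ^+ k) * K1).
have Q0 : 0 <= Q by rewrite !mulr_ge0 // addr_ge0.
have cc0 : 0 <= core_cst R k.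
  by rewrite addr_ge0 // !mulr_ge0 ?pi_ge0 ?hyers_cst_ge0 // addr_ge0.
pose K3 : R := (6 * k%:R + 3) * K2 + (2 * k)%:R * (core_cst R k * K1).
have k3 : 0 <= 6 * k%:R + 3 :> R by rewrite addr_ge0 ?mulr_ge0.
have K30 : 0 <= K3 by rewrite /K3 addr_ge0 // !mulr_ge0.
(* Each extension step gains [d], and N <= 2 C d. *)
pose J := (2 * C)%N.
pose K : R := (2 ^+ k + 1) ^+ J * (K3 + J%:R * K2).
have K0 : 0 <= K by rewrite /K mulr_ge0 ?exprn_ge0 ?addr_ge0 ?mulr_ge0.
(* For s at most this bound, Q s <= Q / (Q + 1) < 1, the strict smallness needed for the lift. *)
exists C, (Q + 1)^-1, K; split => //.
- by rewrite invr_gt0 ltr_wpDl.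
move=> N f s CN f1 s0 sc sumS.
pose d := (N %/ C)%N; have d0 : (0 < d)%N by rewrite divn_gt0.
have dr : (0 : R) < d%:R by rewrite ltr0n.
have dC : (d * C <= N)%N by rewrite leq_divM.
have NdC : (N <= 2 * C * d)%N.
  apply: leq_trans (ltnW (ltn_ceil N C0)) _.
  rewrite -/d mulnC (mulnC 2%N) -mulnA leq_mul2l mul2n -addnn -addn1 leq_add2l.
  by rewrite d0 orbT.
have dN : (d <= N)%N by rewrite leq_div.
have {}sumS : \sum_(u <- cubes k N) defect f u <= K2 * s * d%:R ^+ k.+1.
  apply: le_trans sumS _; rewrite mulrAC mulrC ler_wpM2r //.
  rewrite /K2 -exprMn lerXn2r ?nnegrE ?mulr_ge0 //.
  by rewrite -!natrM ler_nat.
pose m := (2 * k * d)%N; pose H := (k`! * m)%N.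
have dm : (d <= m)%N by rewrite leq_pmull // muln_gt0.
have mH : (m <= H)%N by rewrite leq_pmull ?fact_gt0.
have dH : (d <= H)%N by apply: leq_trans mH.
have H0 : (0 < H)%N by apply: leq_trans dH.
have HN : (k.+2 ^ 2 * H <= N)%N by apply: leq_trans dC; rewrite /H /m /C [(d * _)%N]mulnC !mulnA.
have mN : (m <= N)%N.
  by apply: (leq_trans mH); apply: leq_trans HN; rewrite leq_pmull.
pose g := corrected k H f.
have g1 y : nc (g y) <= 1 by exact: nc_corrected_le1.
have dHX i : d%:R ^+ i <= H%:R ^+ i :> R by rewrite lerXn2r ?nnegrE // ler_nat.
have dX i : (0 : R) < d%:R ^+ i by rewrite exprn_gt0.
have hg x hs : size hs = k -> (x + sumn hs < k`! * m)%N ->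
    nc (1 - cube addn hs g x) <= K1 * s.
  move=> shs xH; have := cube_corrected H0 HN f1 sumS shs xH.
  move=> h; rewrite -(ler_pM2l (dX k.+1)).
  apply: (@le_trans _ _ (H%:R ^+ k.+1 * nc (1 - cube addn hs g x))).
    by rewrite ler_wpM2r ?nc_ge0.
  by apply: le_trans h _; rewrite /K1; lra.
have [||p sp hp] := @phase_of_approx_cubes R k m g (K1 * s) _ g1 _ hg.
- by rewrite mulr_ge0.
- have -> : 3 * ((1 + 2 ^+ k) * (K1 * s)) = Q * s by rewrite /Q; ring.
  apply: (@le_lt_trans _ _ (Q / (Q + 1))); first by rewrite ler_wpM2l.
  by rewrite ltr_pdivrMr ?mul1r ?ltrDl // ltr_wpDl.
exists p => //.
pose f' y := f y * e (- p.[y%:R]).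
have f'1 y : nc (f' y) <= 1 by rewrite ncM nc_e mulr1.
have w y : nc (1 - f' y) = nc (f y - e p.[y%:R]).
  rewrite /f' eN -[1](mulr1 1) -[X in X - _](_ : e p.[y%:R] * conjc (e p.[y%:R]) = 1 * 1).
    by rewrite -mulrBl ncM ncJ nc_e mulr1 ncB.
  by rewrite mul_conjc nc_e expr1n rmorph1 mulr1.
have Em : \sum_(x <- iota 0 m) nc (1 - f' x) <= K3 * s * d%:R.
  apply: (@le_trans _ _ (\sum_(x <- iota 0 m) (nc (f x - g x) + core_cst R k * (K1 * s)))).
    apply: ler_sum_in => x; rewrite mem_iota add0n => xm.
    by rewrite w; apply: le_trans (nc_triangle (g x) _ _) _; rewrite lerD2l hp.
  rewrite big_split /= sum_const_seq size_iota /K3.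
  have -> : ((6 * k%:R + 3) * K2 + (2 * k)%:R * (core_cst R k * K1)) * s * d%:R =
    (6 * k%:R + 3) * (K2 * s * d%:R) + m%:R * (core_cst R k * (K1 * s)).
    by rewrite /m natrM; ring.
  rewrite lerD2r.
  apply: (@le_trans _ _ (\sum_(x <- iota 0 H) nc (f x - g x))).
    apply: ler_sum_subset; first exact: iota_uniq.
      by move=> x; rewrite !mem_iota !add0n /= => xm; apply: leq_trans xm mH.
    by move=> *; apply: nc_ge0.
  have h := sum_f_corrected H0 HN f1 sumS.
  rewrite -(ler_pM2l (dX k)).
  apply: (@le_trans _ _ (H%:R ^+ k * \sum_(x <- iota 0 H) nc (f x - g x))).
    by rewrite ler_wpM2r // sumr_ge0 // => *; apply: nc_ge0.
  by apply: le_trans h _; rewrite exprS; lra.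
have sumS' : \sum_(u <- cubes k N) defect f' u <= K2 * s * d%:R ^+ k.+1.
  apply: le_trans sumS; apply: ler_sum_in => u; rewrite mem_cubes => /andP[/eqP su _].
  by rewrite /defect (cube_mul_phase _ _ sp) // size_behead su.
have := @extend_iter R k f' f'1 N d _ J sumS' d0 mN.
have -> : minn N (2 * k * d + J * d) = N.
  by apply/minn_idPl; apply: leq_trans NdC _; rewrite leq_addl.
under eq_bigr do rewrite w.
move=> /le_trans; apply.
have -> : K2 * s * d%:R ^+ k.+1 / d%:R ^+ k = K2 * s * d%:R.
  by rewrite exprS !mulrA mulfK // gt_eqF.
apply: (@le_trans _ _ (K * s * d%:R)); last first.
  by rewrite ler_wpM2l ?ler_nat // mulr_ge0.
have -> : K * s * d%:R = (2 ^+ k + 1) ^+ J * (K3 * s * d%:R + J%:R * (K2 * s * d%:R)).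
  by rewrite /K; ring.
by rewrite ler_wpM2l ?exprn_ge0 ?addr_ge0 // lerD2r.
Qed.

End Inverse.

(** * Gowers norms as sums over cubes *)

Section Conversion.
Variable R : realType.

Lemma cube_nat_ext hs (g h : nat -> R[i]) x :
  (forall y, (x <= y <= x + sumn hs)%N -> g y = h y) ->
  cube addn hs g x = cube addn hs h x.
Proof.
elim: hs x => [|a hs IH] x gh /=; first by apply: gh => /=; lia.
by congr (_ * conjc _); apply: IH => y yx; apply: gh => /=; lia.
Qed.

Lemma conjnS (m : nat) (z : R[i]) : conjn m.+1 z = conjc (conjn m z).
Proof. by rewrite /conjn /=; case: odd => //=; rewrite conjcK. Qed.

Definition cons_ffun (T : Type) k (a : T) (w : {ffun 'I_k -> T}) : {ffun 'I_k.+1 -> T} :=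
  [ffun i => oapp w a (unlift ord0 i)].

Definition behead_ffun (T : Type) k (w : {ffun 'I_k.+1 -> T}) : {ffun 'I_k -> T} :=
  [ffun i => w (lift ord0 i)].

Lemma cons_ffun0 (T : Type) k (a : T) (w : {ffun 'I_k -> T}) : cons_ffun a w ord0 = a.
Proof. by rewrite ffunE unlift_none. Qed.

Lemma cons_ffunS (T : Type) k (a : T) (w : {ffun 'I_k -> T}) i :
  cons_ffun a w (lift ord0 i) = w i.
Proof. by rewrite ffunE liftK. Qed.

Lemma big_ffunS (S : Type) (idx : S) (op : Monoid.com_law idx) (T : finType) k
    (F : {ffun 'I_k.+1 -> T} -> S) :
  \big[op/idx]_(w : {ffun 'I_k.+1 -> T}) F w =
  \big[op/idx]_(a : T) \big[op/idx]_(w : {ffun 'I_k -> T}) F (cons_ffun a w).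
Proof.
rewrite pair_big /= (reindex (fun p : T * {ffun 'I_k -> T} => cons_ffun p.1 p.2)) //=.
exists (fun w : {ffun 'I_k.+1 -> T} => (w ord0, behead_ffun w)) => [[a w] _|w _] /=.
  rewrite cons_ffun0; congr pair; apply/ffunP => i.
  by rewrite ffunE cons_ffunS.
apply/ffunP => i; rewrite ffunE.
by case: unliftP => [j ->|->] //=; rewrite ffunE.
Qed.

Lemma big_ffun0 (S : Type) (idx : S) (op : Monoid.com_law idx) (T : finType)
    (F : {ffun 'I_0 -> T} -> S) (w0 : {ffun 'I_0 -> T}) :
  \big[op/idx]_(w : {ffun 'I_0 -> T}) F w = F w0.
Proof.
rewrite (big_pred1 w0) // => w; apply/esym/eqP/ffunP => i; by case: i.
Qed.

(** Splitting [w] at its first coordinate is one step of the recursion of [cube]; the half with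
    value true carries one more conjugation. *)
Lemma prod_cube k (A : nmodType) (f : A -> R[i]) (x : A) (h : 'I_k -> A) :
  \prod_(w : {ffun 'I_k -> bool})
     conjn (\sum_(i < k) (w i : nat))%N (f (x + \sum_(i < k) h i *+ w i)) =
  cube +%R [seq h i | i <- enum 'I_k] f x.
Proof.
elim: k x h => [|k IH] x h.
  rewrite (big_ffun0 _ _ [ffun=> false]) !big_ord0 addr0.
  by rewrite (size0nil (s := enum 'I_0)) // size_enum_ord.
rewrite big_ffunS big_bool /= mulrC enum_ordSl /= -map_comp -!IH.
congr (_ * _); last rewrite rmorph_prod.
  apply: eq_bigr => w _; rewrite !big_ord_recl cons_ffun0 mulr0n add0r add0n.
  congr (conjn _ (f (x + _))); last by apply: eq_bigr => i _; rewrite cons_ffunS.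
  by apply: eq_bigr => i _; rewrite cons_ffunS.
apply: eq_bigr => w _; rewrite !big_ord_recl cons_ffun0 mulr1n add1n conjnS addrA.
congr (conjc (conjn _ (f (x + _ + _)))); last by apply: eq_bigr => i _; rewrite cons_ffunS.
by apply: eq_bigr => i _; rewrite cons_ffunS.
Qed.

Lemma sum_ffun_box k M (F : seq nat -> R[i]) :
  \sum_(h : {ffun 'I_k -> 'I_M}) F [seq (h i : nat) | i <- enum 'I_k] =
  \sum_(hs <- box k M) F hs.
Proof.
elim: k F => [|k IH] F.
  rewrite /box big_lists0 (big_ffun0 _ _ (ffun0 (card_ord 0))).
  by rewrite (size0nil (s := enum 'I_0)) // size_enum_ord.
transitivity (\sum_(a <- iota 0 M) \sum_(hs <- box k M) F (a :: hs)); last first.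
  by rewrite /box big_listsS.
rewrite big_ffunS -[iota 0 M]val_enum_ord big_map big_enum /=.
apply: eq_bigr => a _; apply: (etrans _ (IH (fun hs => F (nat_of_ord a :: hs)))).
apply: eq_bigr => h _; rewrite enum_ordSl /= -map_comp cons_ffun0; congr (F (_ :: _)).
by apply: eq_map => i /=; rewrite cons_ffunS.
Qed.

End Conversion.

Section Gowers.
Variable R : realType.

Lemma Re_sum (I : Type) (s : seq I) (F : I -> R[i]) :
  complex.Re (\sum_(i <- s) F i) = \sum_(i <- s) complex.Re (F i).
Proof.
elim: s => [|a s IH]; first by rewrite !big_nil.
by rewrite !big_cons -IH; case: (F a) => ? ?; case: (\sum_(i <- s) F i).
Qed.

Lemma ReM_real (r : R) (z : R[i]) : complex.Re ((r%:C)%C * z) = r * complex.Re z.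
Proof. by case: z => a b /=; rewrite mul0r subr0. Qed.

Lemma gowers_avgE k M (g : nat -> R[i]) : gowers_avg k M g =
  ((M%:R ^- k.+1 : R)%:C)%C * \sum_(u <- box k.+1 M)
    cube addn (behead u) (fun n => g (n %% M)%N) (head 0%N u).
Proof.
congr (_ * _); rewrite [RHS]big_listsS -[iota 0 M in RHS]val_enum_ord.
rewrite big_map big_enum /=; apply: eq_bigr => x _.
rewrite val_enum_ord -[RHS](@sum_ffun_box R k M
  (fun hs => cube addn hs (fun n => g (n %% M)%N) x)).
apply: eq_bigr => h _; rewrite -(prod_cube (fun n => g (n %% M)%N)).
apply: eq_bigr => w _; congr (conjn _ (g ((x + _) %% M)%N)).
by apply: eq_bigr => i _; case: (w i); rewrite ?mul1n ?mul0n ?mulr1n ?mulr0n.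
Qed.

Lemma sum_iota_shift M h (F : nat -> R[i]) : (forall n, F (n + M)%N = F n) ->
  \sum_(a <- iota 0 M) F (h + a)%N = \sum_(a <- iota 0 M) F a.
Proof.
move=> FM; elim: h => [|h <-]; first by apply: eq_bigr.
case: M FM => [|M] FM; first by rewrite !big_nil.
have E (H : nat -> R[i]) :
  \sum_(a <- iota 0 M.+1) H a = \sum_(0 <= a < M.+1) H a.
  by rewrite /index_iota subn0.
rewrite !E big_nat_recr // big_nat_recl //= addrC addn0 addSnnS FM; congr (_ + _).
by apply: eq_bigr => a _; rewrite addSnnS.
Qed.

(** With the other directions fixed, the sum over base point and first direction, each over a full
    period, is |Z|^2. Nonnegativity allows the root in the norm to be undone. *)
Lemma gowers_avg_ge0 k M (g : nat -> R[i]) : (1 <= k)%N ->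
  0 <= complex.Re (gowers_avg k M g).
Proof.
case: k => // k _; rewrite gowers_avgE ReM_real mulr_ge0 ?invr_ge0 ?exprn_ge0 //.
set G := fun n => g (n %% M)%N.
have GM hs n : cube addn hs G (n + M)%N = cube addn hs G n.
  transitivity (cube addn hs (fun m => G (m + M)%N) n).
    rewrite (cube_comp (p := fun m => (m + M)%N) (q := id) (add' := addn)) ?map_id //.
    by move=> x h; rewrite addnAC.
  by apply: eq_cube => m; rewrite /G modnDr.
rewrite /box big_listsS.
under eq_bigr do rewrite big_listsS exchange_big /=.
rewrite exchange_big Re_sum /=; apply: sumr_ge0 => hs _.
set Z := \sum_(a <- iota 0 M) cube addn hs G a.
suff -> : \sum_(a <- iota 0 M) \sum_(h <- iota 0 M)
    cube addn hs G a * conjc (cube addn hs G (a + h)%N) = Z * conjc Z.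
  by rewrite mul_conjc /= sqr_ge0.
rewrite mulr_suml; apply: eq_bigr => a _; rewrite -mulr_sumr; congr (_ * _).
rewrite -rmorph_sum; congr conjc.
exact: (@sum_iota_shift M a (cube addn hs G)).
Qed.

Section Interval.
Variables (k N : nat) (f : nat -> R[i]).
Hypothesis f1 : forall n, (1 <= n <= N)%N -> nc (f n) <= 1.

Let M := (2 ^ k * N).+1.
Let one : nat -> R[i] := fun=> 1.

Definition mcube (g : nat -> R[i]) (u : seq nat) : R[i] :=
  cube addn (behead u) (fun n => ext0 N g (n %% M)%N) (head 0%N u).

Let NM : (N < M)%N.
Proof. by rewrite ltnS leq_pmull // expn_gt0. Qed.

Lemma nc_ext0_le1 (g : nat -> R[i]) : (forall n, (1 <= n <= N)%N -> nc (g n) <= 1) ->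
  forall n, nc (ext0 N g n) <= 1.
Proof. by move=> g1 n; rewrite /ext0; case: ifP => [/g1 //|_]; rewrite nc0. Qed.

Lemma mcubeM u : mcube f u = mcube one u * mcube f u.
Proof.
rewrite -[in RHS]cubeM; apply: eq_cube => n; rewrite /ext0.
by case: ifP => _; rewrite ?mul1r ?mul0r.
Qed.

Lemma mcube1 u : mcube one u = 0 \/ mcube one u = 1.
Proof.
rewrite /mcube; elim: (behead u) (head 0%N u) => [|h hs IH] x /=.
  by rewrite /ext0; case: ifP; [right | left].
case: (IH x) => ->; first by left; rewrite mul0r.
case: (IH (x + h)%N) => ->; rewrite ?conjc0 ?conjc1 ?mulr0 ?mul1r; [by left | by right].
Qed.

(** Where the cube of the indicator vanishes so does that of [f]; elsewhere it is 1. So the gap has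
    nonnegative terms and may be restricted to any family of cubes, such as those that do not wrap
    around. *)
Lemma mcube_gap u : 0 <= complex.Re (mcube one u) - complex.Re (mcube f u).
Proof.
have := mcubeM u; case: (mcube1 u) => ->; first by rewrite mul0r => ->; rewrite subrr.
move=> _; rewrite subr_ge0; apply: le_trans (Re_le_nc _) _ => /=.
by apply: nc_cube_le1 => n; apply: nc_ext0_le1.
Qed.

(** [cubes] starts at 0 and the interval at 1; composing the polynomial with ['X - 1] undoes the
    shift. *)
Definition shift_ext (n : nat) : R[i] := ext0 N f n.+1.

Lemma mcube_shift y hs : (y + sumn hs < N)%N ->
  mcube f (y.+1 :: hs) = cube addn hs shift_ext y /\ mcube one (y.+1 :: hs) = 1.
Proof.
move=> yN; have E (g : nat -> R[i]) :
   mcube g (y.+1 :: hs) = cube addn hs (fun n => ext0 N g n.+1) y.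
  rewrite /mcube /= (@cube_nat_ext _ _ _ (ext0 N g)).
    by rewrite (cube_comp (p := succn) (q := id) (add' := addn)) ?map_id.
  by move=> n yn; rewrite modn_small //; lia.
rewrite !E; split => //; rewrite (@cube_nat_ext _ _ _ (fun=> 1)).
  by elim: hs y {yN E} => //= h hs IH y; rewrite !IH conjc1 mulr1.
by move=> n yn; rewrite /ext0 ifT //; lia.
Qed.

Definition gap := \sum_(u <- box k.+1 M)
  (complex.Re (mcube one u) - complex.Re (mcube f u)).

Lemma sum_cubes_gap : \sum_(u <- cubes k N)
  (1 - complex.Re (cube addn (behead u) shift_ext (head 0%N u))) <= gap.
Proof.
apply: (@le_trans _ _ (\sum_(u <- cubes k N)
   (complex.Re (mcube one ((head 0%N u).+1 :: behead u)) -
    complex.Re (mcube f ((head 0%N u).+1 :: behead u))))).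
  apply: ler_sum_in => -[|y hs]; rewrite mem_cubes //= => /andP[_ yN].
  by have [-> ->] := mcube_shift yN.
apply: (ler_sum_inj (p := fun u => (head 0%N u).+1 :: behead u)
  (g := fun u => complex.Re (mcube one u) - complex.Re (mcube f u))).
- exact: uniq_cubes.
- by move=> [|a s] [|b t]; rewrite !mem_cubes //= => _ _ [-> ->].
- move=> [|y hs]; rewrite mem_cubes //= => /andP[shs yN].
  rewrite mem_box /= shs /=; apply/andP; split; first by lia.
  apply/allP => h hh; have := perm_sumn (perm_to_rem hh) => /=; lia.
- exact: mcube_gap.
Qed.

Let a := complex.Re (gowers_avg k M (ext0 N f)).
Let b := complex.Re (gowers_avg k M (ext0 N one)).

Let M0 : (0 : R) < M%:R ^+ k.+1.
Proof. by rewrite exprn_gt0. Qed.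

Lemma gapE : gap = M%:R ^+ k.+1 * (b - a).
Proof.
rewrite /a /b !gowers_avgE !ReM_real -mulrBr mulrA mulfV ?gt_eqF // mul1r.
by rewrite !Re_sum -sumrB.
Qed.

Lemma avg_one_le1 : b <= 1.
Proof.
rewrite /b gowers_avgE ReM_real Re_sum mulrC ler_pdivrMr // mul1r.
apply: (@le_trans _ _ (\sum_(u <- box k.+1 M) 1)).
  apply: ler_sum => u _; have := mcube1 u; rewrite /mcube => -[] -> //=.
by rewrite sum_const_seq size_box mulr1 natrX.
Qed.

Hypothesis N1 : (1 <= N)%N.

Lemma avg_one_gt0 : 0 < b.
Proof.
rewrite /b gowers_avgE ReM_real Re_sum mulr_gt0 ?invr_gt0 //.
(* The degenerate cube at 1 with zero directions contributes 1. *)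
apply: (@lt_le_trans _ _ (\sum_(u <- [:: 1%N :: nseq k 0%N]) complex.Re (mcube one u))).
  rewrite big_seq1; have [|_ ->] := @mcube_shift 0 (nseq k 0%N); last exact: ltr01.
  by rewrite sumn_nseq mul0n.
apply: ler_sum_subset => //.
  move=> u; rewrite inE => /eqP ->; rewrite mem_box /= size_nseq eqxx /=.
  have M1 : (1 < M)%N by lia.
  by rewrite M1; apply/allP => h /nseqP[-> _].
by move=> u; have := mcube1 u; rewrite /mcube => -[] -> //=.
Qed.

Hypothesis k1 : (1 <= k)%N.

Let a0 : 0 <= a. Proof. exact: gowers_avg_ge0. Qed.

Lemma powR_rootK (x : R) : 0 <= x -> (x `^ (2 ^- k)) ^+ (2 ^ k) = x.
Proof.
move=> x0; rewrite -powR_mulrn ?powR_ge0 // -powRrM natrX mulVf ?powRr1 //.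
Qed.

Lemma gowers_intervalE :
  gowers_interval k N f = a `^ (2 ^- k) / b `^ (2 ^- k).
Proof. by []. Qed.

Let b'0 : 0 < b `^ (2 ^- k).
Proof. by rewrite powR_gt0 // avg_one_gt0. Qed.

Lemma gowers_interval_eq1 : gowers_interval k N f = 1 <-> a = b.
Proof.
rewrite gowers_intervalE; split => [h|->]; last by rewrite mulfV // gt_eqF.
rewrite -(powR_rootK a0) -(powR_rootK (ltW avg_one_gt0)); congr (_ ^+ _).
by rewrite -[LHS](@divfK _ (b `^ (2 ^- k))) ?gt_eqF // h mul1r.
Qed.

Lemma bernoulli (x : R) n : 0 <= x <= 1 -> 1 - n%:R * x <= (1 - x) ^+ n.
Proof.
case/andP=> x0 x1; elim: n => [|n IH]; first by rewrite mul0r subr0.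
have n0 : (0 : R) <= n%:R by [].
have := ler_wpM2l (_ : 0 <= 1 - x) IH; rewrite subr_ge0 => /(_ x1).
rewrite exprS; apply: le_trans; rewrite -natr1.
have : 0 <= n%:R * x * x by rewrite !mulr_ge0.
lra.
Qed.

(** Raise to the power [2 ^ k] and apply Bernoulli's inequality. *)
Lemma gap_le eps : 0 <= eps -> 1 - eps <= gowers_interval k N f ->
  gap <= (2 ^ k)%:R * eps * M%:R ^+ k.+1.
Proof.
move=> eps0; rewrite gowers_intervalE ler_pdivlMr // => h.
rewrite gapE mulrC ler_pM2r //.
have b1 := avg_one_le1; have b0 := avg_one_gt0.
apply: (@le_trans _ _ ((2 ^ k)%:R * eps * b)); last first.
  by rewrite ler_piMr // mulr_ge0.
(* For eps > 1 the base 1 - eps is negative, but then the gap is trivially at most [b]. *)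
have [e1|e1] := leP eps 1; last first.
  apply: (@le_trans _ _ b); first by rewrite gerBl.
  rewrite ler_peMl ?(ltW b0) //.
  have k2 : (1 : R) <= (2 ^ k)%:R by rewrite ler1n expn_gt0.
  by rewrite (le_trans (ltW e1)) // ler_peMl.
have : (1 - eps) ^+ (2 ^ k) * b <= a.
  rewrite -{1}(powR_rootK (ltW b0)) -(powR_rootK a0) -exprMn.
  by rewrite lerXn2r ?nnegrE ?mulr_ge0 ?powR_ge0 ?subr_ge0.
have := @bernoulli eps (2 ^ k); rewrite eps0 e1 => /(_ isT).
move=> /(ler_wpM2r (ltW b0)); lra.
Qed.

End Interval.
End Gowers.

(** * The exact case *)

Section Exact.
Variable R : realType.

Lemma interpolation k (f : nat -> R) : exists2 p : {poly R}, (size p <= k)%N &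
  forall i, (i < k)%N -> p.[i%:R] = f i.
Proof.
elim: k => [|k [p sp pf]]; first by exists 0; rewrite ?size_poly0.
pose q : {poly R} := \prod_(i <- iota 0 k) ('X - (i%:R)%:P).
have sq : size q = k.+1 by rewrite size_prod_XsubC size_iota.
have qk : q.[k%:R] != 0.
  rewrite horner_prod prodf_seq_neq0; apply/allP => i; rewrite mem_iota add0n => ik.
  by rewrite hornerXsubC subr_eq0 eqr_nat gtn_eqF.
have q0 i : (i < k)%N -> q.[i%:R] = 0.
  move=> ik; apply/eqP; rewrite -/(root q _) -[q](big_map (fun i : nat => i%:R) xpredT (fun z => 'X - z%:P)).
  by rewrite root_prod_XsubC map_f // mem_iota.
exists (p + ((f k - p.[k%:R]) / q.[k%:R]) *: q).
  rewrite (leq_trans (size_polyD _ _)) // geq_max (leq_trans sp) //=.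
  by rewrite (leq_trans (size_scale_leq _ _)) // sq.
move=> i; rewrite hornerD hornerZ ltnS leq_eqVlt => /predU1P[->|ik].
  by rewrite divfK // addrC subrK.
by rewrite (q0 _ ik) mulr0 addr0 pf.
Qed.

(** Interpolate the first k values; every later value is determined by the k preceding ones, being
    the top vertex of a vanishing difference. *)
Lemma poly_of_ddiff k N (f : nat -> R) :
  (forall x, (x + k < N)%N -> ddiff addn (nseq k 1%N) f x = 0) ->
  exists2 p : {poly R}, (size p <= k)%N & forall x, (x < N)%N -> f x = p.[x%:R].
Proof.
move=> hf; have [p sp pf] := interpolation k f; exists p => //.
suff H x : (x < N)%N -> f x - p.[x%:R] = 0 by move=> x /H/eqP; rewrite subr_eq0 => /eqP.
elim/ltn_ind: x => x IH xN.
have [xk|kx] := ltnP x k; first by rewrite pf // subrr.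
have snk : sumn (nseq k 1%N) = k by rewrite sumn_nseq mul1n.
have xE : (x - k + k = x)%N by rewrite subnK.
have := hf (x - k)%N; rewrite xE => /(_ xN) h.
have : ddiff addn (nseq k 1%N) (fun y => f y - p.[y%:R]) (x - k)%N = 0.
  transitivity (ddiff addn (nseq k 1%N) f (x - k)%N -
     ddiff addn (nseq k 1%N) (fun y => p.[y%:R]) (x - k)%N).
    rewrite -mulN1r -ddiffZ -ddiffD; apply: eq_ddiff => y.
    by rewrite mulN1r.
  by rewrite h ddiff_poly_nat ?subrr // size_nseq.
rewrite (@ddiff_nat_ext _ _ _ (fun y => if y == (x - k + sumn (nseq k 1%N))%N
   then f x - p.[x%:R] else 0)).
  rewrite ddiff_top; last by elim: (k).
  by move/eqP; rewrite mulf_eq0 signr_eq0 /= => /eqP.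
move=> y; rewrite snk xE => /andP[_ yx]; case: eqP => [-> //|/eqP yx'].
have ylx : (y < x)%N by rewrite ltn_neqAle yx'.
by apply: IH => //; apply: ltn_trans xN.
Qed.

(** At [d = 0], being near an integer is being one, and [lift_ones] makes the differences vanish
    outright. *)
Lemma exact_phase k N (g : nat -> R[i]) : (forall y, nc (g y) <= 1) ->
  (forall u, u \in cubes k N -> cube addn (behead u) g (head 0%N u) = 1) ->
  exists2 p : {poly R}, (size p <= k)%N & forall x, (x < N)%N -> g x = e p.[x%:R].
Proof.
move=> g1 hg.
have hg' x hs : size hs = k -> (x + sumn hs < N)%N -> cube addn hs g x = 1.
  by move=> shs xN; apply: (hg (x :: hs)); rewrite mem_cubes /= shs eqxx.
have [phi hphi] := boolp.choice (fun x => polar (g x)).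
have gphi x : (x < N)%N -> g x = e (phi x).
  move=> xN; have sn : sumn (nseq k 0%N) = 0%N by rewrite sumn_nseq mul0n.
  have := hg' x (nseq k 0%N); rewrite size_nseq sn addn0 => /(_ erefl xN) h.
  have : 1 <= nc (g x).
    rewrite -[X in X <= _](nc1 R) -h cubeE ncM ncJ ler_piMr ?nc_ge0 //.
    exact: nc_face_le1.
  move=> h1; have {}h1 : nc (g x) = 1 by apply/eqP; rewrite eq_le g1.
  by rewrite {1}hphi h1 rmorph1 mul1r.
have [|psi psiE hpsi] := @lift_ones R k N phi 0.
  move=> x xN; apply: near_int_e; last exact: ltr01.
  rewrite -cube_e (@cube_nat_ext _ _ _ g); first by rewrite hg' ?subrr ?nc0 ?size_nseq // sumn_nseq mul1n.
  by move=> y; rewrite sumn_nseq mul1n => yx; rewrite gphi //; lia.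
have [|p sp hp] := @poly_of_ddiff k N psi.
  by move=> x /hpsi; rewrite normr_le0 => /eqP.
by exists p => // x xN; rewrite gphi // -hp // (e_mod1 (psiE x)).
Qed.

End Exact.

(** * Polynomial phases and cubes modulo M *)

Section Wrap.
Variable R : realType.
Local Notation cubeZ := (cube (+%R : int -> int -> int)).

Lemma cube_neq0 (A : Type) (add : A -> A -> A) hs (f : A -> R[i]) x :
  cube add hs f x != 0 -> f x != 0.
Proof. by rewrite cubeE mulf_eq0 negb_or => /andP[]. Qed.

Lemma cube_neq0_nat hs (f : nat -> R[i]) x : cube addn hs f x != 0 ->
  forall h, h \in hs -> f (x + h)%N != 0.
Proof.
elim: hs => //= h hs IH; rewrite mulf_eq0 negb_or conjc_eq0 => /andP[/IH IH' c0].
by move=> y; rewrite inE => /predU1P[->|/IH' //]; apply: cube_neq0 c0.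
Qed.

Lemma cubeZ_ext (D : nat) hs (f g : int -> R[i]) (x : int) :
  (forall h, h \in hs -> - (D%:Z) <= h <= D%:Z) ->
  (forall v : int, x - (size hs * D)%:Z <= v <= x + (size hs * D)%:Z -> f v = g v) ->
  cubeZ hs f x = cubeZ hs g x.
Proof.
elim: hs x => [|h hs IH] x hD fg /=; first by apply: fg; rewrite mul0n; lia.
have hh : - (D%:Z) <= h <= D%:Z by apply: hD; rewrite mem_head.
have hs' y : y \in hs -> - (D%:Z) <= y <= D%:Z.
  by move=> ys; apply: hD; rewrite inE ys orbT.
rewrite /= mulSn in fg.
by congr (_ * conjc _); apply: IH => // v; set P := (size hs * D)%N in fg * => vx; apply: fg; lia.
Qed.

(* Directions mod M are represented by the integer of absolute value < N that
   keeps the edge at x inside [1, N]; no vertex then wraps around. *)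
Lemma mcube_wrap k N u :
  let M := (2 ^ k * N).+1 in
  u \in box k.+1 M -> mcube k N (fun=> 1 : R[i]) u != 0 ->
  exists2 hs : seq int, size hs = k & forall f : nat -> R[i],
   mcube k N f u = cubeZ hs
     (fun v => if (1 <= v <= N%:Z) then f `|v|%N else 0) (head 0%N u)%:Z.
Proof.
move=> M uM; case: u uM => [|x hs] uM; first by rewrite mem_box in uM.
move: uM; rewrite mem_box /= eqSS => /andP[/eqP shs /andP[xM /allP hM]] one0.
have kk : (k < 2 ^ k)%N by rewrite ltn_expl.
have kN : (k * N + N <= 2 ^ k * N)%N by rewrite -mulSnr leq_mul2r kk orbT.
have NM : (N < M)%N by rewrite ltnS leq_pmull // expn_gt0.
have ext1 n : ext0 N (fun=> 1 : R[i]) n != 0 -> (1 <= n <= N)%N.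
  by rewrite /ext0; case: ifP => //; rewrite eqxx.
have xN : (1 <= x <= N)%N.
  by have /ext1 := cube_neq0 one0; rewrite /= -/M (modn_small xM).
have hN h : h \in hs -> (1 <= (x + h) %% M <= N)%N.
  by move=> hhs; apply: ext1; apply: cube_neq0_nat one0 _ hhs.
pose s (h : nat) : int := if (x + h < M)%N then h%:Z else h%:Z - M%:Z.
exists (map s hs) => [|f]; first by rewrite size_map.
pose Z (v : int) := ext0 N f `|(v %% M%:Z)%Z|%N.
have ZM v : Z (v + M%:Z) = Z v by rewrite /Z modzDr.
have -> : mcube k N f (x :: hs) = cubeZ (map Posz hs) Z x%:Z.
  transitivity (cube addn hs (fun n => Z n%:Z) x).
    by apply: eq_cube => n; rewrite /Z modz_nat.
  by apply: (@cube_comp R nat int addn +%R Posz Posz _ hs Z x) => y h; rewrite PoszD.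
have -> : cubeZ (map Posz hs) Z x%:Z = cubeZ (map s hs) Z x%:Z.
  elim: (hs) (x%:Z) => //= h t IH y; rewrite !IH; congr (_ * conjc _).
  have sE : s h = h%:Z \/ s h = h%:Z - M%:Z.
    by rewrite /s; case: ifP; [left | right].
  case: sE => -> //.
  have E : forall l v, cubeZ l Z (v + M%:Z) = cubeZ l Z v.
    by elim=> //= b l IHl v; rewrite IHl addrAC IHl.
  by rewrite -(E _ (y + (h%:Z - M%:Z))) -addrA subrK.
(* Vertices lie within [k * N] of [x], and k N + N <= 2^k N < M. A nonnegative vertex is therefore
   its own residue, and a negative one has residue above [N], where the extension is 0. *)
apply: (@cubeZ_ext N).
  move=> h /mapP[h0 h0s ->]; have := hN _ h0s; rewrite /s.
  have hm : (h0 < M)%N := hM _ h0s.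
  case: (ltnP (x + h0) M) => xh; first by rewrite (modn_small xh) => xhN; move: xN xhN; clear; lia.
  have -> : (x + h0 = (x + h0 - M) + M)%N by rewrite subnK.
  rewrite modnDr modn_small; last by move: xN xh hm NM; clear; lia.
  by move: xN xh hm; clear; lia.
move=> v; rewrite size_map shs => vx; rewrite /Z.
have MZ : M%:Z != 0 by [].
have [v0|v0] := leP 0 v.
  have vM : v < M%:Z by move: vx xN kN; rewrite /M; lia.
  rewrite modz_small ?v0 // /ext0.
  by congr (if _ then _ else _); move: v0; clear; lia.
rewrite -[(v %% _)%Z]modzDr modz_small; last by move: vx xN kN; rewrite /M; lia.
rewrite /ext0 !ifF //; first by move: v0; clear; lia.
by apply/negbTE; move: vx xN kN v0; rewrite /M; lia.
Qed.

(** A polynomial on the integers does not descend modulo [M], hence the passage to integer cubes: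
    there the phase contributes [e] of a vanishing k-th difference and only the indicator
    remains. *)
Lemma mcube_poly k N (f : nat -> R[i]) (p : {poly R}) u :
  (size p <= k)%N -> (forall n, (1 <= n <= N)%N -> f n = ePoly p n) ->
  u \in box k.+1 (2 ^ k * N).+1 -> mcube k N f u = mcube k N (fun=> 1) u.
Proof.
move=> sp fp uM; have [u0|u0] := eqVneq (mcube k N (fun=> 1 : R[i]) u) 0.
  by rewrite mcubeM u0 mul0r.
have [hs shs hE] := mcube_wrap uM u0; rewrite !hE.
set one := fun v : int => if (1 <= v <= N%:Z) then 1 : R[i] else 0.
transitivity (cubeZ hs (fun v => one v * e p.[v%:~R]) (head 0%N u)%:Z).
  apply: eq_cube => v; rewrite /one; case: ifP => [/andP[v1 vN]|_]; last by rewrite mul0r.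
  rewrite mul1r fp; last by move: v1 vN; clear; lia.
  by rewrite /ePoly natr_absz ger0_norm //; apply: le_trans v1.
rewrite cubeM (cube_e +%R hs (fun v : int => p.[v%:~R])).
rewrite (@ddiff_comp R _ _ +%R +%R intr intr hs (horner p)); last by move=> *; rewrite rmorphD.
by rewrite ddiff_poly ?size_map ?shs // e0 mulr1.
Qed.

End Wrap.

(** * From the gap between averages to the theorem *)

Section Final.
Variable R : realType.

Lemma L1_shift N (f : nat -> R[i]) (p : {poly R}) :
  L1 N (fun n => f n - ePoly (p \Po ('X - 1%:P)) n) =
  N%:R^-1 * \sum_(x <- iota 0 N) nc (shift_ext N f x - e p.[x%:R]).
Proof.
rewrite /L1 big_add1 /= /index_iota subn0; congr (_ * _).
rewrite !big_seq; apply: eq_bigr => x; rewrite mem_iota add0n => /andP[_ xN].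
rewrite /shift_ext /ext0 ifT //; congr (nc (_ - e _)).
by rewrite horner_comp !hornerE -natr1 addrK.
Qed.

Lemma size_shift (p : {poly R}) : size (p \Po ('X - 1%:P)) = size p.
Proof. by rewrite size_comp_poly2 // size_XsubC. Qed.

Lemma gowers_interval_poly k N (f : nat -> R[i]) (p : {poly R}) :
  (1 <= k)%N -> (1 <= N)%N ->
  (forall n, (1 <= n <= N)%N -> nc (f n) <= 1) ->
  (size p <= k)%N -> (forall n, (1 <= n <= N)%N -> f n = ePoly p n) ->
  gowers_interval k N f = 1.
Proof.
move=> k1 N1 f1 sp fp; apply/gowers_interval_eq1 => //.
apply/eqP; rewrite eq_sym -subr_eq0; have := gapE k N f.
have -> : gap k N f = 0.
  by rewrite /gap big_seq big1 // => u uM; rewrite (mcube_poly sp fp uM) subrr.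
move/esym/eqP; rewrite mulf_eq0 => /orP[|//].
by rewrite gt_eqF // exprn_gt0.
Qed.

Lemma phase_of_gap_le0 k N (f : nat -> R[i]) :
  (forall n, (1 <= n <= N)%N -> nc (f n) <= 1) -> gap k N f <= 0 ->
  exists2 p : {poly R}, (size p <= k)%N &
    forall n, (1 <= n <= N)%N -> f n = ePoly p n.
Proof.
move=> f1 g0; have s1 y : nc (shift_ext N f y) <= 1 by apply: nc_ext0_le1.
have [|p sp hp] := @exact_phase R k N (shift_ext N f) s1.
  move=> u uc; apply: Re_eq1; first exact: nc_cube_le1.
  have := le_trans (sum_cubes_gap k f1) g0.
  rewrite (perm_big _ (perm_to_rem uc)) big_cons /=.
  set Y := \sum_(v <- _) _; suff : 0 <= Y by lra.
  apply: sumr_ge0 => v _; rewrite subr_ge0; apply: le_trans (Re_le_nc _) _.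
  exact: nc_cube_le1.
exists (p \Po ('X - 1%:P)); first by rewrite size_shift.
case=> // x xN; have := hp x xN; rewrite /shift_ext /ext0 ifT // => ->.
by rewrite /ePoly horner_comp !hornerE -natr1 addrK.
Qed.

(** Termwise D <= t/2 + D^2 / (2 t), used in place of Cauchy-Schwarz; the choice t = sqrt eps
    balances the two terms. *)
Lemma sum_defect_le k N (f : nat -> R[i]) (t : R) : 0 < t ->
  (forall n, (1 <= n <= N)%N -> nc (f n) <= 1) ->
  \sum_(u <- cubes k N) defect (shift_ext N f) u <=
    t / 2 * N%:R ^+ k.+1 + gap k N f / t.
Proof.
move=> t0 f1.
have s1 y : nc (shift_ext N f y) <= 1 by apply: nc_ext0_le1.
apply: (@le_trans _ _ (\sum_(u <- cubes k N) (t / 2 +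
   (1 - complex.Re (cube addn (behead u) (shift_ext N f) (head 0%N u))) / t))).
  apply: ler_sum => u _; rewrite /defect.
  have := nc_1B_le (nc_cube_le1 addn (behead u) (head 0%N u) s1).
  set z := cube _ _ _ _; set D := nc (1 - z) => h.
  rewrite -(ler_pM2r t0) mulrDl divfK ?gt_eqF //.
  have : 0 <= (t - D) ^+ 2 by rewrite sqr_ge0.
  nra.
rewrite big_split /= sum_const_seq -mulr_suml; apply: lerD.
  rewrite mulrC ler_wpM2l ?divr_ge0 ?(ltW t0) // -natrX ler_nat.
  by rewrite size_filter -(size_box k.+1 N) count_size.
by rewrite ler_wpM2r ?invr_ge0 ?(ltW t0) // sum_cubes_gap.
Qed.

Lemma near_extremal k : (1 <= k)%N -> exists (N0 : nat) (K : R),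
  [/\ (0 < N0)%N, 0 <= K & forall N (f : nat -> R[i]) (eps : R),
    (N0 <= N)%N -> (forall n, (1 <= n <= N)%N -> nc (f n) <= 1) ->
    0 <= eps -> 1 - eps <= gowers_interval k N f ->
    exists p : {poly R}, (size p <= k)%N /\
      L1 N (fun n => f n - ePoly p n) <= K * Num.sqrt eps].
Proof.
move=> k1; have [N0 [c0 [K [N00 c00 K0 inv]]]] := inverse_cubes R k1.
(* [A] compares M^(k+1) with N^(k+1), and [C] collects both terms of [sum_defect_le] at t = sqrt
   eps. *)
pose A : R := (2 ^ k).+1%:R ^+ k.+1.
pose C : R := 2^-1 + (2 ^ k)%:R * A.
have A0 : 0 <= A by rewrite exprn_ge0.
have C0 : 0 < C by rewrite ltr_wpDr ?mulr_ge0 ?invr_gt0.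
(* The second summand covers large eps: if C sqrt eps > c0, the trivial bound 2 on |f - 1| is at
   most (2 C / c0) sqrt eps. *)
exists N0, (K * C + 2 * C / c0); split => //.
  by rewrite addr_ge0 ?divr_ge0 ?mulr_ge0 // ltW.
move=> N f eps NN f1 eps0 heps.
have N1 : (1 <= N)%N by apply: leq_trans NN.
have Nr : (0 : R) < N%:R by rewrite ltr0n.
have g_le := gap_le N1 k1 eps0 heps.
(* [sum_defect_le] divides by t = sqrt eps, so eps = 0 goes through the exact case. *)
have [e0|ne0] := eqVneq eps 0.
  rewrite e0 mulr0 mul0r in g_le; rewrite e0 sqrtr0 mulr0.
  have [p sp hp] := phase_of_gap_le0 f1 g_le.
  exists p; split => //; rewrite /L1 big_nat big1 ?mulr0 // => n.
  by rewrite ltnS => /hp ->; rewrite subrr nc0.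
set t := Num.sqrt eps; have t0 : 0 < t by rewrite sqrtr_gt0 lt_def ne0.
have tt : t * t = eps by rewrite -expr2 sqr_sqrtr.
have [tc|tc] := leP (C * t) c0; last first.
  exists 0; split; first by rewrite size_poly0.
  apply: (@le_trans _ _ 2); last first.
    apply: (@le_trans _ _ (2 * C / c0 * t)).
      by rewrite mulrAC ler_pdivlMr // -mulrA ler_pM2l // ltW.
    by rewrite ler_wpM2r ?(ltW t0) // lerDr mulr_ge0 // ltW.
  rewrite /L1 ler_pdivrMl // -{2}(size_iota 1 N) -sum_const_seq.
  rewrite /index_iota subSS subn0; apply: ler_sum_in => n.
  rewrite mem_iota add1n ltnS => nN; apply: le_trans (nc_leB _ _) _.
  by rewrite /ePoly nc_e -[2]/(1 + 1) lerD // f1.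
have s1 y : nc (shift_ext N f y) <= 1 by apply: nc_ext0_le1.
have hS : \sum_(u <- cubes k N) defect (shift_ext N f) u <= C * t * N%:R ^+ k.+1.
  apply: le_trans (sum_defect_le k t0 f1) _.
  have MN : ((2 ^ k * N).+1%:R ^+ k.+1 : R) <= A * N%:R ^+ k.+1.
    rewrite /A -exprMn lerXn2r ?nnegrE ?mulr_ge0 // -natrM ler_nat mulSn.
    by rewrite -[X in (X <= _)%N]add1n leq_add2r.
  have -> : C * t * N%:R ^+ k.+1 = t / 2 * N%:R ^+ k.+1 +
      (2 ^ k)%:R * (A * N%:R ^+ k.+1) * t by rewrite /C; field.
  rewrite lerD2l ler_pdivrMr //; apply: le_trans g_le _.
  rewrite -[X in _ <= X]mulrA tt [X in X <= _]mulrAC ler_wpM2r //.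
  by rewrite ler_wpM2l.
have [p sp hp] := inv N (shift_ext N f) (C * t) NN s1 (mulr_ge0 (ltW C0) (ltW t0)) tc hS.
exists (p \Po ('X - 1%:P)); rewrite size_shift; split => //.
rewrite L1_shift ler_pdivrMl //; apply: le_trans hp _.
rewrite mulrC ler_pM2l // mulrA ler_wpM2r ?(ltW t0) // lerDl.
by rewrite divr_ge0 ?mulr_ge0 // ltW.
Qed.

Import numFieldNormedType.Exports.

Lemma cvg_mul_sqrt (K : R) : (K * Num.sqrt x @[x --> (0 : R)^'+] --> (0 : R))%classic.
Proof.
apply: cvg_at_right_filter.
have : (K * Num.sqrt x @[x --> (0 : R)] --> K * Num.sqrt (0 : R))%classic.
  by apply: cvgM; [exact: cvg_cst | exact: sqrt_continuous].
by rewrite sqrtr0 mulr0.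
Qed.

End Final.

Theorem theorem1p11 (R : realType) (k : nat) (hk : (1 <= k)%N) :
  exists (N0 : nat) (c : R -> R),
    (forall eps, 0 <= eps -> 0 <= c eps) /\
    (c x @[x --> 0^'+] --> 0)%classic /\
    forall (N : nat) (f : nat -> R[i]),
      (N0 <= N)%N ->
      (forall n, (1 <= n <= N)%N -> ComplexField.Normc.normc (f n) <= 1) ->
      ((gowers_interval k N f = 1 <->
         exists p : {poly R}, (size p <= k)%N /\
           forall n, (1 <= n <= N)%N -> f n = ePoly p n) /\
       (forall eps : R, 0 <= eps -> 1 - eps <= gowers_interval k N f ->
         exists p : {poly R}, (size p <= k)%N /\
           L1 N (fun n => f n - ePoly p n) <= c eps)).
Proof.
have [N0 [K [N00 K0 near]]] := near_extremal R hk.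
exists N0, (fun x => K * Num.sqrt x); split.
  by move=> eps _; rewrite mulr_ge0 ?sqrtr_ge0.
split; first exact: cvg_mul_sqrt.
move=> N f NN f1; have N1 : (1 <= N)%N by apply: leq_trans NN.
split; last by move=> eps; apply: near.
split=> [/(gowers_interval_eq1 _ N1 hk)|[p [sp fp]]]; last first.
  exact: gowers_interval_poly fp.
move=> ab; have g0 : gap k N f <= 0 by rewrite gapE ab subrr mulr0.
by have [p sp fp] := phase_of_gap_le0 f1 g0; exists p.
Qed.
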